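(* For any initial composition $(\alpha,\beta)\in\mathbb N^2\setminus\{(0,0)\}$, the limit laws $W^{DT}_{(\alpha,\beta)}$ and $W^{CT}_{(\alpha,\beta)}$ of a large two-color Pólya urn process (in discrete time and in continuous time, respectively) are determined by their moments.
   Context: Standing assumptions on the urn: $a,b,c,d$ are nonnegative integers with $a+b=c+d=:S$ (balanced), $bc\neq0$ (non triangular), $m:=a-c=d-b$, $\sigma:=m/S$, and the urn is large, i.e. $\sigma>\frac12$. Let $u_2(x,y)=\frac1S(bx-cy)$. Discrete time urn: start with $\alpha$ red and $\beta$ black balls. At each time step a ball is drawn uniformly at random among the balls of the urn and put back; if it is red, $a$ red and $b$ black balls are added; if it is black, $c$ red and $d$ black balls are added. $U^{DT}_{(\alpha,\beta)}(n)\in\mathbb N^2$ is the composition vector (number of red balls, number of black balls) after $n$ draws. Continuous time urn: start at time $0$ with $\alpha$ red and $\beta$ black balls. At any moment each ball carries an exponential clock of parameter $1$, all clocks being independent; when the clock of a red ball rings, $a$ red and $b$ black balls are added; when the clock of a black ball rings, $c$ red and $d$ black balls are added. $U^{CT}_{(\alpha,\beta)}(t)$ is the composition vector at time $t\ge0$. It is known that the limits $$W^{DT}_{(\alpha,\beta)}:=\lim_{n\to+\infty}\frac1{n^{\sigma}}u_2\left(U^{DT}_{(\alpha,\beta)}(n)\right),\qquad W^{CT}_{(\alpha,\beta)}:=\lim_{t\to+\infty}e^{-mt}u_2\left(U^{CT}_{(\alpha,\beta)}(t)\right)$$ exist almost surely and in $L^p$ for every $p\ge1$. *)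

(* Defs.v *)
From HB Require Import structures.
From mathcomp Require Import all_boot all_order all_algebra finmap.
From mathcomp Require Import all_classical all_reals all_analysis.
Set Implicit Arguments.
Unset Strict Implicit.
Unset Printing Implicit Defensive.
Import Order.TTheory GRing.Theory Num.Theory.
Import numFieldNormedType.Exports.
Local Open Scope classical_set_scope.
Local Open Scope ring_scope.

Section moments.
Context {R : realType}.

Definition has_moments (mu : probability R R) :=
  forall k : nat, mu.-integrable setT (fun x : R => (x ^+ k)%:E).

Definition moment (mu : probability R R) (k : nat) : \bar R :=
  (\int[mu]_x (x ^+ k)%:E)%E.

Definition moment_determined (mu : probability R R) :=
  has_moments mu /\
  forall nu : probability R R, has_moments nu ->
    (forall k, moment nu k = moment mu k) ->
    forall A : set R, measurable A -> nu A = mu A.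

End moments.

Section mutual_independence.
Context (d : measure_display) (T : measurableType d) (R : realType).

Definition mutually_independent (P : probability T R) (I : eqType)
    (X : I -> {RV P >-> R}) :=
  forall (s : seq I) (A : I -> set R), uniq s ->
    (forall i, measurable (A i)) ->
    P [set w | forall i, i \in s -> A i (X i w)] =
    (\prod_(i <- s) P (X i @^-1` A i))%E.

End mutual_independence.

(* The replacement matrix is [[a, b], [c, d]]; a composition is the pair
   (number of red balls, number of black balls). *)
Section urn.
Context (R : realType) (a b c d : nat).

Definition urn_S : R := (a + b)%:R.
Definition urn_m : R := a%:R - c%:R.
Definition urn_sigma : R := urn_m / urn_S.

Definition large_urn :=
  [/\ (a + b = c + d)%N, (b * c != 0)%N & 1 / 2 < urn_sigma].

Definition u2 (x : nat * nat) : R := (b%:R * x.1%:R - c%:R * x.2%:R) / urn_S.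

Definition urn_kernel (x y : nat * nat) : R :=
  x.1%:R / (x.1 + x.2)%:R * (y == (x.1 + a, x.2 + b)%N)%:R +
  x.2%:R / (x.1 + x.2)%:R * (y == (x.1 + c, x.2 + d)%N)%:R.

Context (alpha beta : nat).

Section discrete_time.
Context (dT : measure_display) (T : measurableType dT) (P : probability T R).

(* The Markov chain started at (alpha, beta) with transition matrix urn_kernel,
   in product form so that null histories need no separate treatment. *)
Definition is_urn_DT (U : nat -> {RV P >-> (nat * nat)%type}) :=
  P [set w | U 0%N w = (alpha, beta)] = 1%E /\
  forall (n : nat) (h : nat -> nat * nat) (y : nat * nat),
    P [set w | (forall k, (k <= n)%N -> U k w = h k) /\ U n.+1 w = y] =
    (P [set w | forall k, (k <= n)%N -> U k w = h k] *
     (urn_kernel (h n) y)%:E)%E.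

Definition is_W_DT (U : nat -> {RV P >-> (nat * nat)%type})
    (W : {RV P >-> R}) :=
  {ae P, forall w,
    u2 (U n w) / n%:R `^ urn_sigma @[n --> \oo] --> (W w : R)}.

End discrete_time.

(* A ball whose clock rings is relabelled, so that each label carries exactly
   one clock.  A label (i, p) consists of the number i of an initial ball (the
   first alpha of them are red) and of a descent p, most recent step first.
   When the clock of a red ball (i, q) rings, the ball is replaced by the balls
   (i, j :: q), j <= a + b: j = 0 is the ball itself with a fresh clock,
   1 <= j <= a are the added red balls and a < j the added black ones.  When the
   clock of a black ball (i, q) rings, the balls (i, j :: q), j <= c + d, appear:
   j < c are the added red balls, c <= j are the added black ones and the ball
   itself. *)
Definition label : Type := (nat * seq nat)%type.

Fixpoint red_from (i : nat) (p : seq nat) : bool :=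
  match p with
  | [::] => (i < alpha)%N
  | j :: q => if red_from i q then (j <= a)%N else (j < c)%N
  end.

Fixpoint ball_from (i : nat) (p : seq nat) : bool :=
  match p with
  | [::] => (i < alpha + beta)%N
  | j :: q => ball_from i q &&
      (j <= if red_from i q then a + b else c + d)%N
  end.

Section continuous_time.
Context (dT : measure_display) (T : measurableType dT) (P : probability T R).
Variable clock : label -> {RV P >-> R}.

Definition exponential_clocks :=
  mutually_independent clock /\
  forall (l : label) (A : set R), measurable A ->
    distribution P (clock l) A = exponential_prob 1 A.

Fixpoint birth_from (i : nat) (p : seq nat) (w : T) : R :=
  match p with
  | [::] => 0
  | j :: q => birth_from i q w + clock (i, q) w
  end.

Definition in_urn (t : R) (w : T) (l : label) :=
  [/\ ball_from l.1 l.2, birth_from l.1 l.2 w <= t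
    & t < birth_from l.1 l.2 w + clock l w].

(* fset_set sends an infinite set to the empty one; almost surely only finitely
   many balls are present at any time. *)
Definition U_CT (t : R) (w : T) : nat * nat :=
  (#|` fset_set [set l | in_urn t w l /\ red_from l.1 l.2]|%fset,
   #|` fset_set [set l | in_urn t w l /\ ~~ red_from l.1 l.2]|%fset).

Definition is_W_CT (W : {RV P >-> R}) :=
  {ae P, forall w,
    expR (- (urn_m * t)) * u2 (U_CT t w) @[t --> +oo] --> (W w : R)}.

End continuous_time.
End urn.

(* Main.v *)
Require Import Defs.
From HB Require Import structures.
From mathcomp Require Import all_boot all_order all_algebra finmap.
From mathcomp Require Import all_classical all_reals all_analysis.
From mathcomp Require Import measurable_realfun zify ring lra.
Import Order.TTheory GRing.Theory Num.Theory.
Import numFieldNormedType.Exports.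
Local Open Scope classical_set_scope.
Local Open Scope ring_scope.

(** Both limits have exponential moments: E exp(s |W|) is finite for some
    s > 0.  Such a law is determined by its moments.  Since Fatou's lemma
    carries exponential bounds from approximating variables to W, it is enough
    to bound E exp(theta X), for small theta of both signs and uniformly, along
    variables X that converge to W almost surely.  Write S = a + b for the
    number of balls added at each draw; the urn is large when 2m > S, and this
    is what makes the second order terms below stay bounded.

    Determinacy (exponential_moment_determined).  If nu has the moments of mu,
    it has the same exponential moments, because the power series of cosh has
    nonnegative terms.  Expanding cosines around a frequency l inside the
    integrals shows that the integrals of x ^ k cos(l x + phi) against mu and
    nu, which agree at l = 0 by hypothesis, agree at every frequency, in steps
    of size s / 2.  Hence mu and nu integrate trigonometric polynomials alike.
    The iterates of v |-> (3 v - v ^ 3) / 2 at sin(l x + phi) are bounded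
    trigonometric polynomials that converge to the sign of the sine, and
    letting l tend to 0 gives the sign of x - y, hence the distribution
    functions.

    Discrete time (mgf_bound).  With T_n the number of balls after n draws and
    g_n the product of the 1 + m / T_k for k < n, the variable u2(U_n) / g_n is
    a martingale with bounded jumps of u2(U_n).  One draw turns the parameter
    theta into theta (1 + m / T_n) and costs a factor exp(2 m ^ 2 theta ^ 2).
    The exponent A |theta| g_n + D theta ^ 2 (g_n ^ 2 - T_n / T_0) absorbs this
    cost because T_n (1 + m / T_n) ^ 2 - T_(n+1) >= 2m - S > 0.  Finally g_n is
    at most a constant times n ^ sigma.

    Continuous time (generations_mgf).  The urn is a branching process: a ball
    of weight u (the value of u2 on that single ball) lives an exponential time
    c and is then replaced by S + 1 independent children, whose weights add up
    to (1 + m) u and whose contributions are discounted by exp(- m c).  Cut the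
    tree after n generations.  The bound exp(theta u + K theta ^ 2) on the
    moment generating function is preserved by one more generation: the first
    order terms match, and the second order ones obey
    K (S + 1) E exp(- 2 m c) + O(1) <= K, where
    (S + 1) E exp(- 2 m c) = (S + 1) / (1 + 2m) < 1.
    Almost surely only finitely many balls are born before a given time
    (non_explosion), so the cut process is eventually the urn itself
    (U_CT_generations). *)

(** * Laws with an exponential moment are determined by their moments *)

Section same_integral.
Context {R : realType} (mu nu : probability R R).

(** Integrability is included, so that the functions with this property are
    closed under linear combinations and dominated limits. *)
Definition same_int (f : R -> R) :=
  [/\ mu.-integrable setT (EFin \o f), nu.-integrable setT (EFin \o f) &
      (\int[mu]_x (f x)%:E = \int[nu]_x (f x)%:E)%E].

Lemma same_intD f g : same_int f -> same_int g -> same_int (fun x => f x + g x).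
Proof.
move=> [fm fn fe] [gm gn ge]; split.
- by have := integrableD measurableT fm gm.
- by have := integrableD measurableT fn gn.
- under eq_integral do rewrite EFinD.
  under [RHS]eq_integral do rewrite EFinD.
  by rewrite !(integralD_EFin measurableT) // fe ge.
Qed.

Lemma same_intZ c f : same_int f -> same_int (fun x => c * f x).
Proof.
move=> [fm fn fe]; split.
- by have := integrableZl measurableT c fm.
- by have := integrableZl measurableT c fn.
- under eq_integral do rewrite EFinM.
  under [RHS]eq_integral do rewrite EFinM.
  by rewrite !integralZl // fe.
Qed.

Lemma same_int_sum (I : Type) (s : seq I) (F : I -> R -> R) :
  (forall i, same_int (F i)) -> same_int (fun x => \sum_(i <- s) F i x).
Proof.
move=> hF; elim: s => [|i s IH].
  have -> : (fun x : R => \sum_(i <- [::]) F i x) = cst 0.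
    by apply/funext => x; rewrite big_nil.
  split; [exact: integrable0|exact: integrable0|].
  by rewrite !integral0.
have -> : (fun x : R => \sum_(j <- i :: s) F j x)
   = (fun x => F i x + \sum_(j <- s) F j x).
  by apply/funext => x; rewrite big_cons.
exact: same_intD.
Qed.

Lemma same_int_cvg (f_ : nat -> R -> R) (f g : R -> R) :
  (forall n, same_int (f_ n)) ->
  mu.-integrable setT (EFin \o g) -> nu.-integrable setT (EFin \o g) ->
  (forall n x, `|f_ n x| <= g x) ->
  (forall x, f_ n x @[n --> \oo] --> f x) ->
  same_int f.
Proof.
move=> hf gm gn fg ff.
have mf_ n : measurable_fun setT (f_ n).
  by have [/measurable_int/measurable_EFinP] := hf n.
have mf : measurable_fun setT f by apply: measurable_fun_cvg => //.
have dct (m : probability R R) : m.-integrable setT (EFin \o g) ->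
    m.-integrable setT (EFin \o f) /\
    (\int[m]_x (f_ n x)%:E)%E @[n --> \oo] --> (\int[m]_x (f x)%:E)%E.
  move=> ig.
  have [] := @dominated_convergence _ _ R m setT measurableT
     (fun n => EFin \o f_ n) (EFin \o f) (EFin \o g).
  - by move=> n; exact/measurable_EFinP.
  - exact/measurable_EFinP.
  - by apply: aeW => x _; apply: cvg_EFin; [exact: nearW|exact: ff].
  - by [].
  - by apply: aeW => x n _; rewrite /= lee_fin.
  - by [].
have [im cm] := dct mu gm; have [inn cn] := dct nu gn.
split => //.
have e : (fun n => \int[mu]_x (f_ n x)%:E)%E = (fun n => \int[nu]_x (f_ n x)%:E)%E.
  by apply/funext => n; have [] := hf n.
rewrite e in cm.
exact: (cvg_unique _ cm cn).
Qed.

Lemma same_int_bounded (f_ : nat -> R -> R) (f : R -> R) :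
  (forall n, same_int (f_ n)) -> (forall n x, `|f_ n x| <= 1) ->
  (forall x, f_ n x @[n --> \oo] --> f x) -> same_int f.
Proof.
move=> hf f1 ff; apply: (same_int_cvg f_ f (cst 1)) => //;
  exact: finite_measure_integrable_cst.
Qed.

End same_integral.

Section exp_series.
Context {R : realType}.
Implicit Types x y u v : R.

Lemma series_exp_coeff_le_expR y n : 0 <= y -> series (exp_coeff y) n <= expR y.
Proof.
move=> y0; rewrite /expR; apply: nondecreasing_cvgn_le.
  by apply: nondecreasing_series => k _ _; exact: exp_coeff_ge0.
exact: is_cvg_series_exp_coeff.
Qed.

Lemma expX_le_expR y k : 0 <= y -> y ^+ k <= k`!%:R * expR y.
Proof.
move=> y0; rewrite -ler_pdivrMl ?ltr0n ?fact_gt0// mulrC.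
apply: le_trans (series_exp_coeff_le_expR y k.+1 y0).
rewrite /series /= big_nat_recr//= lerDr.
by apply: sumr_ge0 => i _; exact: exp_coeff_ge0.
Qed.

(** The j-th term of the expansion of v |-> cos (u + v) in powers of v: one of
    the two products vanishes, according to the parity of j. *)
Definition cos_taylor u v (j : nat) : R :=
  cos u * cos_coeff v j - sin u * sin_coeff v j.

Lemma cvg_cos_taylor u v : series (cos_taylor u v) @ \oo --> cos (u + v).
Proof.
have -> : series (cos_taylor u v) =
    (fun n => cos u * series (cos_coeff v) n - sin u * series (sin_coeff v) n).
  by apply/funext => n; rewrite /series /= !mulr_sumr -sumrB.
rewrite cosD; apply: cvgB; apply: cvgMr => //=; rewrite unlock.
  exact: is_cvg_series_cos_coeff.
exact: is_cvg_series_sin_coeff.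
Qed.

Lemma cos_taylor_even u v j : ~~ odd j ->
  cos_taylor u v j = (-1) ^+ j./2 * (v ^+ j / j`!%:R) * cos u.
Proof.
rewrite /cos_taylor /cos_coeff /sin_coeff /= => /negbTE ->.
by rewrite /= mul1r !mul0r mulr0 subr0 mulrC -!mulrA.
Qed.

Lemma cos_taylor_odd u v j : odd j ->
  cos_taylor u v j = (-1) ^+ j.-1./2 * (v ^+ j / j`!%:R) * cos (u + pi / 2).
Proof.
rewrite /cos_taylor /cos_coeff /sin_coeff /= => ->.
rewrite /= mul1r !mul0r mulr0 sub0r cosDpihalf -!mulrA; ring.
Qed.

Lemma norm_cos_taylor_le u v j : `|cos_taylor u v j| <= exp_coeff `|v| j.
Proof.
have key (e : nat) (z : R) :
   `|(-1) ^+ e * (v ^+ j / j`!%:R) * cos z| <= exp_coeff `|v| j.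
  rewrite !normrM normrX normrN1 expr1n mul1r normfV normrX normr_nat /exp_coeff /=.
  by rewrite ler_piMr ?mulr_ge0 ?exprn_ge0// ?cos_max.
by case: (boolP (odd j)) => h; [rewrite cos_taylor_odd|rewrite cos_taylor_even].
Qed.

Lemma norm_series_cos_taylor_le u v n : `|series (cos_taylor u v) n| <= expR `|v|.
Proof.
apply: le_trans (series_exp_coeff_le_expR `|v| n (normr_ge0 _)).
apply: le_trans (ler_norm_sum _ _ _) _; rewrite /series /=.
by apply: ler_sum => i _; exact: norm_cos_taylor_le.
Qed.

End exp_series.

Section fourier.
Context {R : realType} (mu nu : probability R R) (s : R).
Hypothesis s0 : 0 < s.
Hypothesis mus : mu.-integrable setT (fun x => (expR (s * `|x|))%:E).
Hypothesis nus : nu.-integrable setT (fun x => (expR (s * `|x|))%:E).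
Hypothesis momE : forall k, same_int mu nu (fun x => x ^+ k).

(** The expansion of cos((l + h) x + phi) in powers of h x has terms
    x ^ j cos(l x + psi), whose integrals agree by hypothesis.  Its partial sums
    are at most exp(|h| |x|) <= exp(s |x| / 2); the other half of exp(s |x|)
    dominates x ^ k, so the expansion can be integrated term by term. *)
Lemma same_int_Xcos_step (l h : R) : `|h| <= s / 2 ->
  (forall k phi, same_int mu nu (fun x => x ^+ k * cos (l * x + phi))) ->
  forall k phi, same_int mu nu (fun x => x ^+ k * cos ((l + h) * x + phi)).
Proof.
move=> hs IH k phi.
pose C := k`!%:R * (2 / s) ^+ k.
have C0 : 0 <= C by rewrite mulr_ge0// exprn_ge0// divr_ge0// ltW.
apply: (same_int_cvg mu nu
   (fun n x => x ^+ k * series (cos_taylor (l * x + phi) (h * x)) n) _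
   (fun x => C * expR (s * `|x|))).
- move=> n; rewrite /series /=.
  under eq_fun do rewrite mulr_sumr.
  apply: same_int_sum => j.
  have [oj|ej] := boolP (odd j).
    under eq_fun => x do rewrite cos_taylor_odd//.
    rewrite (_ : (fun _ => _) = (fun x => ((-1) ^+ j.-1./2 * h ^+ j / j`!%:R) *
       (x ^+ (k + j) * cos (l * x + (phi + pi / 2))))); last first.
      by apply/funext => x; rewrite exprMn exprD addrA; ring.
    exact/same_intZ/IH.
  under eq_fun => x do rewrite cos_taylor_even//.
  rewrite (_ : (fun _ => _) = (fun x => ((-1) ^+ j./2 * h ^+ j / j`!%:R) *
     (x ^+ (k + j) * cos (l * x + phi)))); last first.
    by apply/funext => x; rewrite exprMn exprD; ring.
  exact/same_intZ/IH.
- by have := integrableZl measurableT C mus.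
- by have := integrableZl measurableT C nus.
- move=> n x; rewrite normrM.
  have e2 : expR (s * `|x|) = expR (s / 2 * `|x|) * expR (s / 2 * `|x|).
    by rewrite -expRD; congr expR; field.
  rewrite e2 mulrA; apply: ler_pM => //.
    have y0 : 0 <= s / 2 * `|x| by rewrite mulr_ge0// divr_ge0// ltW.
    have e1 : `|x| = (2 / s) * (s / 2 * `|x|) by field; rewrite gt_eqF.
    rewrite normrX {1}e1 exprMn /C [k`!%:R * _]mulrC -[leRHS]mulrA.
    by rewrite ler_wpM2l ?exprn_ge0 ?divr_ge0 ?(ltW s0)// expX_le_expR.
  apply: le_trans (norm_series_cos_taylor_le _ _ _) _.
  by rewrite ler_expR normrM ler_wpM2r.
- move=> x; apply: cvgMr; rewrite (_ : (l + h) * x + phi = l * x + phi + h * x); last by ring.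
  exact: cvg_cos_taylor.
Qed.

(** At frequency 0 the statement is about moments; frequency l is reached in
    n + 1 equal steps of length at most s / 2. *)
Lemma same_int_cos (l phi : R) : same_int mu nu (fun x => cos (l * x + phi)).
Proof.
have H0 k phi' : same_int mu nu (fun x => x ^+ k * cos (0 * x + phi')).
  under eq_fun => x do rewrite mul0r add0r mulrC.
  exact: same_intZ.
have [n hn] : exists n : nat, `|l / n.+1%:R| <= s / 2.
  have := @archi_boundP R (`|l| * (2 / s)).
  move=> /(_ (mulr_ge0 (normr_ge0 _) (divr_ge0 (ler0n _ 2) (ltW s0)))) hn.
  exists (Num.bound (`|l| * (2 / s))).
  rewrite normrM normfV normr_nat ler_pdivrMr ?ltr0n// -ler_pdivrMl ?divr_gt0//.
  rewrite invf_div mulrC; apply: le_trans (ltW hn) _.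
  by rewrite ler_nat.
have H m : forall k phi', same_int mu nu (fun x => x ^+ k * cos ((m%:R * (l / n.+1%:R)) * x + phi')).
  elim: m => [|m IH] k phi'; first by under eq_fun => x do rewrite mul0r.
  rewrite -natr1 mulrDl mul1r.
  exact: same_int_Xcos_step.
have := H n.+1 0%N phi.
under eq_fun do rewrite expr0 mul1r.
by rewrite mulrC divfK// pnatr_eq0.
Qed.

End fourier.

Section trigonometric_polynomials.
Context {R : realType}.

(** A term of the list is a coefficient, a frequency and a phase.  Arbitrary
    phases make sines unnecessary and products easy. *)
Definition trig_poly (f : R -> R) := exists l : seq (R * R * R),
  forall x, f x = \sum_(p <- l) p.1.1 * cos (p.1.2 * x + p.2).

Lemma trig_polyD f g : trig_poly f -> trig_poly g -> trig_poly (fun x => f x + g x).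
Proof. by move=> [l lE] [k kE]; exists (l ++ k) => x; rewrite big_cat/= lE kE. Qed.

Lemma trig_polyZ c f : trig_poly f -> trig_poly (fun x => c * f x).
Proof.
move=> [l lE]; exists [seq (c * p.1.1, p.1.2, p.2) | p <- l] => x.
by rewrite big_map lE mulr_sumr; apply: eq_bigr => p _; rewrite mulrA.
Qed.

Lemma trig_poly_sum (I : Type) (s : seq I) (F : I -> R -> R) :
  (forall i, trig_poly (F i)) -> trig_poly (fun x => \sum_(i <- s) F i x).
Proof.
move=> hF; elim: s => [|i s IH].
  by exists [::] => x; rewrite !big_nil.
under eq_fun do rewrite big_cons.
exact: trig_polyD.
Qed.

Lemma trig_poly_cos l phi : trig_poly (fun x => cos (l * x + phi)).
Proof. by exists [:: (1, l, phi)] => x; rewrite big_seq1 mul1r. Qed.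

Lemma trig_polyM f g : trig_poly f -> trig_poly g -> trig_poly (fun x => f x * g x).
Proof.
move=> [l lE] [k kE].
under eq_fun => x do rewrite lE kE mulr_suml.
apply: trig_poly_sum => p.
under eq_fun => x do rewrite mulr_sumr.
apply: trig_poly_sum => q.
rewrite (_ : (fun _ => _) = (fun x => (p.1.1 * q.1.1 / 2) *
   (cos ((p.1.2 + q.1.2) * x + (p.2 + q.2)) +
    cos ((p.1.2 - q.1.2) * x + (p.2 - q.2))))).
  by apply/trig_polyZ/trig_polyD; exact: trig_poly_cos.
apply/funext => x.
rewrite (_ : (p.1.2 + q.1.2) * x + (p.2 + q.2) =
  (p.1.2 * x + p.2) + (q.1.2 * x + q.2)); last by ring.
rewrite (_ : (p.1.2 - q.1.2) * x + (p.2 - q.2) =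
  (p.1.2 * x + p.2) - (q.1.2 * x + q.2)); last by ring.
set u := p.1.2 * x + p.2; set v := q.1.2 * x + q.2.
by rewrite (cosD u v) (cosB u v) -/u; field.
Qed.

Lemma trig_poly_same_int (mu nu : probability R R) f :
  (forall l phi, same_int mu nu (fun x => cos (l * x + phi))) ->
  trig_poly f -> same_int mu nu f.
Proof.
move=> h [l /funext ->].
by apply: same_int_sum => p; exact: same_intZ.
Qed.

End trigonometric_polynomials.

Section sign.
Context {R : realType}.
Implicit Types v : R.

(** An odd polynomial map of [-1, 1] that fixes -1, 0 and 1, attracting at
    -1 and 1: its iterates are polynomials that converge to the sign. *)
Definition smoothstep v : R := (3 * v - v ^+ 3) / 2.

Lemma smoothstepN v : smoothstep (- v) = - smoothstep v.
Proof. by rewrite /smoothstep; field. Qed.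

Lemma iter_smoothstepN n v : iter n smoothstep (- v) = - iter n smoothstep v.
Proof. by elim: n => //= n ->; rewrite smoothstepN. Qed.

(** Since 1 - smoothstep w = (1 - w) (1 - w (1 + w) / 2) and the iterates
    increase, each iteration shrinks the distance to 1 by at least 1 - v / 2. *)
Lemma iter_smoothstep_bnd n v : 0 < v <= 1 ->
  v <= iter n smoothstep v <= 1 /\
  1 - iter n smoothstep v <= (1 - v / 2) ^+ n * (1 - v).
Proof.
move=> /andP[v0 v1]; elim: n => [|n [/andP[IH1 IH2] IH3]].
  by rewrite /= lexx v1 expr0 mul1r lexx.
rewrite iterS; set w := iter n smoothstep v in IH1 IH2 IH3 *.
have -> : smoothstep w = w + w * (1 - w) * (1 + w) / 2 by rewrite /smoothstep; field.
have w0 : 0 <= w by lra.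
have w2 : 0 <= w * w by rewrite mulr_ge0.
have w3 : w * w <= 1 by rewrite mulr_ile1.
have e : 1 - (w + w * (1 - w) * (1 + w) / 2) = (1 - w) * (1 - w * (1 + w) / 2).
  by field.
split; last first.
  rewrite e mulrC exprS -[leRHS]mulrA; apply: ler_pM => //; [nra|lra|nra].
apply/andP; split; last by rewrite -subr_ge0 e; apply: mulr_ge0; [lra|nra].
have : 0 <= w * (1 - w) * (1 + w) by rewrite !mulr_ge0//; lra.
lra.
Qed.

Lemma norm_iter_smoothstep n v : `|v| <= 1 -> `|iter n smoothstep v| <= 1.
Proof.
have pos (w : R) : 0 < w <= 1 -> `|iter n smoothstep w| <= 1.
  move=> w01; have [/andP[h1 h2] _] := iter_smoothstep_bnd n w w01.
  case/andP: w01 => w0 _.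
  by rewrite ger0_norm// (le_trans _ h1)// ltW.
have [v0|v0|->] := ltgtP v 0.
- rewrite ltr0_norm// => h.
  by rewrite -[v]opprK iter_smoothstepN normrN pos// oppr_gt0 v0.
- by rewrite gtr0_norm// => h; rewrite pos// v0.
- move=> _; rewrite (_ : iter n smoothstep 0 = 0) ?normr0//.
  by elim: n {pos} => //= n ->; rewrite /smoothstep; field.
Qed.

Lemma cvg_iter_smoothstep v : `|v| <= 1 ->
  iter n smoothstep v @[n --> \oo] --> (Num.sg v : R).
Proof.
have pos (w : R) : 0 < w <= 1 -> iter n smoothstep w @[n --> \oo] --> (1 : R).
  move=> w01; have B n := iter_smoothstep_bnd n w w01; case/andP: w01 => w0 w1.
  apply: (@squeeze_cvgr _ _ _ _ (fun n => 1 - (1 - w / 2) ^+ n * (1 - w)) (cst (1 : R))).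
  - by apply: nearW => n; have [/andP[_ ->]] := B n; rewrite /= andbT; lra.
  - rewrite -[X in _ --> X]subr0; apply: cvgB; first exact: cvg_cst.
    rewrite -[X in _ --> X](mul0r (1 - w)); apply: cvgMl.
    by apply: cvg_expr; rewrite ger0_norm; lra.
  - exact: cvg_cst.
have [v0|v0|->] := ltgtP v 0.
- rewrite ltr0_norm// => h; rewrite ltr0_sg//.
  rewrite (_ : (fun n => _) = (fun n => - iter n smoothstep (- v))).
    by apply: cvgN; apply: pos; rewrite oppr_gt0 v0.
  by apply/funext => n; rewrite iter_smoothstepN opprK.
- by rewrite gtr0_norm// => h; rewrite gtr0_sg//; apply: pos; rewrite v0.
- move=> _; rewrite sgr0 (_ : (fun n => _) = cst 0); first exact: cvg_cst.
  by apply/funext; elim=> //= n ->; rewrite /smoothstep; field.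
Qed.

End sign.

Section uniqueness.
Context {R : realType} (mu nu : probability R R).
Hypothesis cosE : forall l phi, same_int mu nu (fun x => cos (l * x + phi)).

Lemma same_int_sg_sin l phi :
  same_int mu nu (fun x => Num.sg (sin (l * x + phi))).
Proof.
have sinE x : sin (l * x + phi) = cos (l * x + (phi - pi / 2)).
  by rewrite addrA -[in LHS](subrK (pi / 2) (l * x + phi)) sinDpihalf.
apply: (same_int_bounded mu nu (fun n x => iter n smoothstep (sin (l * x + phi)))).
- move=> n; apply: trig_poly_same_int => //.
  elim: n => /= [|n IH].
    by under eq_fun do rewrite sinE; exact: trig_poly_cos.
  under eq_fun => x.
    rewrite (_ : smoothstep _ = 3 / 2 * iter n smoothstep (sin (l * x + phi)) +
     (- (1 / 2)) * (iter n smoothstep (sin (l * x + phi)) *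
       (iter n smoothstep (sin (l * x + phi)) *
       iter n smoothstep (sin (l * x + phi))))); last by rewrite /smoothstep; field.
    over.
  apply: trig_polyD; apply: trig_polyZ => //.
  by do 2 apply: trig_polyM => //.
- by move=> n x; apply/norm_iter_smoothstep/sin_max.
- by move=> x; apply/cvg_iter_smoothstep/sin_max.
Qed.

(** The sine of (x - y) / (n + 1) has the sign of x - y as soon as |x - y| is
    below n + 1. *)
Lemma same_int_sg y : same_int mu nu (fun x => Num.sg (x - y)).
Proof.
apply: (same_int_bounded mu nu (fun n x => Num.sg (sin (n.+1%:R^-1 * (x - y))))).
- move=> n; under eq_fun do rewrite mulrBr; exact: same_int_sg_sin.
- by move=> n x; rewrite normr_sg; case: (_ != 0).
- move=> x; apply: cvg_near_cst.
  near=> n.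
  have n0 : 0 < n.+1%:R^-1 :> R by rewrite invr_gt0.
  have hn : `|x - y| < n.+1%:R.
    apply: (@lt_trans _ _ n%:R); last by rewrite ltr_nat.
    by near: n; exact: nbhs_infty_gtr.
  have pos z : 0 < z -> z < n.+1%:R -> Num.sg (sin (n.+1%:R^-1 * z)) = 1.
    move=> z0 zn; apply: gtr0_sg; apply: sin_gt0_pi; rewrite mulr_gt0//=.
    apply: lt_le_trans (_ : 1 <= _); first by rewrite mulrC ltr_pdivrMr// mul1r.
    by apply: le_trans (pi_ge2 _); lra.
  have [d0|d0|d0] := ltgtP (x - y) 0.
  - by rewrite -[X in _ * X]opprK mulrN sinN sgrN pos ?oppr_gt0 ?ltr0_sg// -(ltr0_norm d0).
  - rewrite pos//; last by rewrite gtr0_norm// in hn.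
    by rewrite gtr0_sg.
  - by rewrite d0 mulr0 sin0.
Unshelve. all: by end_near. Qed.

(** The sign of x - (y + 1 / (n + 1)) tends to -1 at x = y too, so that the
    limit is constant on each side of the half line. *)
Lemma same_int_indic_itvoy y : same_int mu nu (\1_`]y, +oo[).
Proof.
suff H : same_int mu nu (fun x => if x <= y then -1 else 1).
  rewrite (_ : \1__ = (fun x : R => 2^-1 * (1 + (if x <= y then -1 else 1)))).
    apply/same_intZ/same_intD => //.
    have := cosE 0 0; under eq_fun do rewrite mul0r addr0 cos0; exact.
  apply/funext => x; rewrite indicE /=.
  rewrite mem_setE in_itv/= andbT ltNge; case: ifP => _ /=; first by rewrite subrr mulr0.
  by field.
apply: (same_int_bounded mu nu (fun n x => Num.sg (x - (y + n.+1%:R^-1)))).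
- by move=> n; exact: same_int_sg.
- by move=> n x; rewrite normr_sg; case: (_ != 0).
- move=> x; apply: cvg_near_cst; have [xy|xy] := leP x y.
    apply: nearW => n; rewrite ltr0_sg// subr_lt0 (le_lt_trans xy)//.
    by rewrite ltrDl invr_gt0.
  have d0 : 0 < x - y by rewrite subr_gt0.
  near=> n; apply: gtr0_sg; rewrite subr_gt0 -ltrBrDl.
  by near: n; exact: near_infty_natSinv_lt (PosNum d0).
Unshelve. all: by end_near. Qed.

Lemma same_cos_unique A : measurable A -> nu A = mu A.
Proof.
pose G : set (set R) := @RGenOInfty.G R.
apply: (measure_unique G (fun n => `]- n%:R, +oo[%classic)).
- exact: RGenOInfty.measurableE.
- move=> _ _ [x ->] [y ->]; exists (Num.max x y).
  by apply/seteqP; split => z /=; rewrite !in_itv/= !andbT gt_max => /andP.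
- by move=> n; exists (- n%:R).
- apply/seteqP; split => // x _; exists (Num.bound `|x|) => //=.
  rewrite in_itv/= andbT ltrNl.
  by apply: le_lt_trans (archi_boundP (normr_ge0 x)); rewrite -normrN ler_norm.
- move=> _ [y ->]; have [_ _] := same_int_indic_itvoy y.
  by rewrite !integral_indic// !setIT => ->.
- by move=> n; rewrite ltey_eq fin_num_measure.
Qed.

End uniqueness.

Section exponential_moment.
Context {R : realType} (mu : probability R R) (s : R).
Hypothesis s0 : 0 < s.

Lemma measurable_expRM (a : R) :
  measurable_fun setT (fun x : R => (expR (a * x))%:E).
Proof.
apply/measurable_EFinP; apply: measurableT_comp => //; exact: mulrl_measurable.
Qed.

Lemma measurable_expRM_norm (a : R) :
  measurable_fun setT (fun x : R => (expR (a * `|x|))%:E).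
Proof.
apply/measurable_EFinP; apply: measurableT_comp => //; exact: measurableT_comp.
Qed.

Lemma integrable_expR_norm :
  (\int[mu]_x (expR (s * x))%:E < +oo)%E ->
  (\int[mu]_x (expR (- s * x))%:E < +oo)%E ->
  mu.-integrable setT (fun x => (expR (s * `|x|))%:E).
Proof.
move=> hp hn.
have ip (a : R) : (\int[mu]_x (expR (a * x))%:E < +oo)%E ->
    mu.-integrable setT (fun x => (expR (a * x))%:E).
  move=> h; apply/integrableP; split; first exact: measurable_expRM.
  by under eq_integral do rewrite gee0_abs ?lee_fin ?expR_ge0//.
apply: le_integrable (integrableD measurableT (ip _ hp) (ip _ hn)) => //.
  exact: measurable_expRM_norm.
move=> x _; rewrite /= lee_fin !(ger0_norm (ltW (expR_gt0 _))) (ger0_norm (_ : 0 <= _ + _)) ?addr_ge0 ?expR_ge0//.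
have [x0|x0] := leP 0 x; first by rewrite ger0_norm// lerDl expR_ge0.
by rewrite ltr0_norm// mulrN -mulNr lerDr expR_ge0.
Qed.

Lemma integrable_moment :
  mu.-integrable setT (fun x => (expR (s * `|x|))%:E) ->
  has_moments mu.
Proof.
move=> h k; pose C := k`!%:R * (s^-1) ^+ k.
apply: le_integrable (integrableZl measurableT C h) => //.
  by apply/measurable_EFinP; exact: exprn_measurable.
move=> x _; rewrite /= lee_fin normrX.
rewrite (ger0_norm (_ : 0 <= C * _)); last first.
  by rewrite mulr_ge0 ?expR_ge0// mulr_ge0// exprn_ge0// invr_ge0 ltW.
have e1 : `|x| = s^-1 * (s * `|x|) by field; rewrite gt_eqF.
rewrite {1}e1 exprMn /C [k`!%:R * _]mulrC -[leRHS]mulrA.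
rewrite ler_wpM2l ?exprn_ge0 ?invr_ge0 ?(ltW s0)//.
by rewrite expX_le_expR// mulr_ge0// ltW.
Qed.

End exponential_moment.

Section determinacy.
Context {R : realType} (mu : probability R R) (s : R).
Hypothesis s0 : 0 < s.
Hypothesis mus : mu.-integrable setT (fun x => (expR (s * `|x|))%:E).

Let cosh_coeffE n (x : R) : exp_coeff (s * x) n + exp_coeff (- s * x) n =
  (s ^+ n / n`!%:R + (- s) ^+ n / n`!%:R) * x ^+ n.
Proof. by rewrite /exp_coeff /= !exprMn; ring. Qed.

(** Adding the two exponentials cancels the odd powers.  The remaining terms
    are nonnegative, so that monotone convergence applies to any law that has
    moments, without knowing that the sum is integrable. *)
Lemma integral_cosh_series (nu : probability R R) :
  (\int[nu]_x (expR (s * x) + expR (- s * x))%:E =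
   \sum_(n <oo) \int[nu]_x (exp_coeff (s * x) n + exp_coeff (- s * x) n)%:E)%E.
Proof.
have c0 n (x : R) : 0 <= exp_coeff (s * x) n + exp_coeff (- s * x) n.
  rewrite /exp_coeff /= -mulrDl mulr_ge0// mulNr exprNn.
  have [on|en] := boolP (odd n).
    by rewrite -signr_odd on expr1 mulN1r subrr.
  by rewrite -signr_odd (negbTE en) expr0 mul1r addr_ge0// exprn_even_ge0.
rewrite -integral_nneseries//; last 2 first.
  - move=> n; apply/measurable_EFinP.
    under eq_fun do rewrite cosh_coeffE.
    by apply: measurable_funM => //; exact: exprn_measurable.
  - by move=> n x _; rewrite lee_fin.
apply: eq_integral => x _; apply/esym/cvg_lim => //.
rewrite (_ : (fun _ => _) = EFin \o (series (exp_coeff (s * x)) \+ series (exp_coeff (- s * x)))).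
  apply: cvg_EFin; first exact: nearW.
  by apply: cvgD; exact: is_cvg_series_exp_coeff.
by apply/funext => n; rewrite /series /= -big_split sumEFin.
Qed.

(** The exponential moment of nu is computed from its moments by the cosh
    series; then the cosines have the same integrals. *)
Theorem exponential_moment_determined : moment_determined mu.
Proof.
have mm := integrable_moment _ _ s0 mus.
split => // nu nm nE A mA.
have momE k : same_int mu nu (fun x => x ^+ k).
  by split; [exact: mm|exact: nm|have := nE k; rewrite /moment => ->].
suff nus : nu.-integrable setT (fun x => (expR (s * `|x|))%:E).
  apply: same_cos_unique => // l phi.
  exact: (@same_int_cos _ mu nu s).
have e : (\int[nu]_x (expR (s * x) + expR (- s * x))%:E =
          \int[mu]_x (expR (s * x) + expR (- s * x))%:E)%E.
  rewrite !integral_cosh_series; apply: eq_eseriesr => n _.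
  have : same_int mu nu (fun x => exp_coeff (s * x) n + exp_coeff (- s * x) n).
    by rewrite (funext (cosh_coeffE n)); exact: same_intZ.
  by case.
have fin : (\int[nu]_x (expR (s * x) + expR (- s * x))%:E < +oo)%E.
  rewrite e; apply: le_lt_trans (_ : (\int[mu]_x (2 * expR (s * `|x|))%:E < +oo)%E).
    apply: ge0_le_integral => //.
    - by under eq_fun do rewrite EFinD; apply: emeasurable_funD; exact: measurable_expRM.
    - by under eq_fun do rewrite EFinM; apply: emeasurable_funM => //; exact: measurable_expRM_norm.
    - move=> x _; rewrite lee_fin mulr_natl mulr2n lerD// ler_expR ?mulNr -?mulrN.
        by rewrite ler_pM2l// ler_norm.
      by rewrite ler_pM2l// -normrN ler_norm.
  have /integrableP[_] := integrableZl measurableT 2 mus.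
  by under eq_integral do rewrite gee0_abs ?mule_ge0 ?lee_fin ?expR_ge0// -EFinM.
apply: integrable_expR_norm => //.
  apply: le_lt_trans fin; apply: ge0_le_integral => //.
  - exact: measurable_expRM.
  - by under eq_fun do rewrite EFinD; apply: emeasurable_funD; exact: measurable_expRM.
  - by move=> x _; rewrite lee_fin lerDl expR_ge0.
apply: le_lt_trans fin; apply: ge0_le_integral => //.
- exact: measurable_expRM.
- by under eq_fun do rewrite EFinD; apply: emeasurable_funD; exact: measurable_expRM.
- by move=> x _; rewrite lee_fin lerDr expR_ge0.
Qed.

End determinacy.

(** * Exponential bounds pass to almost sure limits *)

Section fatou_bound.
Context (R : realType) (dT : measure_display) (T : measurableType dT)
  (P : probability T R).

Lemma measurable_limn_einf (f_ : nat -> T -> \bar R) :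
  (forall n, measurable_fun setT (f_ n)) ->
  measurable_fun setT (fun x => limn_einf (f_ ^~ x)).
Proof.
move=> mf_; rewrite /limn_einf; apply: measurableT_comp => //.
by apply: measurable_fun_limn_esup => n; exact: measurableT_comp.
Qed.

Lemma limn_einf_ge0 (u : nat -> \bar R) :
  (forall n, (0 <= u n)%E) -> (0 <= limn_einf u)%E.
Proof.
move=> u0; rewrite limn_einf_lim; apply: lime_ge; first exact: is_cvg_einfs.
by apply: nearW => n; apply: le_ereal_inf_tmp => _ [m _ <-]; exact: u0.
Qed.

Lemma fatou_le (f_ : nat -> T -> \bar R) (f : T -> \bar R) (C : \bar R) :
  (forall n, measurable_fun setT (f_ n)) -> measurable_fun setT f ->
  (forall n x, (0 <= f_ n x)%E) -> (forall x, (0 <= f x)%E) ->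
  {ae P, forall x, f_ n x @[n --> \oo] --> f x} ->
  (forall n, (\int[P]_x f_ n x <= C)%E) ->
  (\int[P]_x f x <= C)%E.
Proof.
move=> mf_ mf f_0 f0 ff fC.
have ml := measurable_limn_einf f_ mf_.
have l0 x := limn_einf_ge0 (f_ ^~ x) (f_0 ^~ x).
apply: (@le_trans _ _ (\int[P]_x (limn_einf (f_ ^~ x)))%E).
  apply: ae_ge0_le_integral => //.
  by apply: filterS ff => x fx _; rewrite (cvg_limn_einf_sup fx).1.
apply: le_trans (fatou P measurableT mf_ _) _ => //.
rewrite limn_einf_lim; apply: lime_le; first exact: is_cvg_einfs.
apply: nearW => n; apply: le_trans (fC n).
by apply: ereal_inf_lbound; exists n => //=.
Qed.

Lemma distribution_moment_determined (W : {RV P >-> R}) (s : R) : 0 < s ->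
  (\int[P]_w (expR (s * W w))%:E < +oo)%E ->
  (\int[P]_w (expR (- s * W w))%:E < +oo)%E ->
  moment_determined (distribution P W).
Proof.
move=> s0 hp hn; apply: (@exponential_moment_determined _ _ s) => //.
apply: integrable_expR_norm.
- by rewrite ge0_integral_distribution//; exact: measurable_expRM.
- by rewrite ge0_integral_distribution//; exact: measurable_expRM.
Qed.

End fatou_bound.

(** * One step of the discrete time urn *)

Lemma measurable_nat_nat (A : set (nat * nat)) : measurable A.
Proof.
apply: countable_measurable; last exact: countableP.
move=> [x y]; rewrite (_ : [set _] = [set x] `*` [set y]).
  by apply: measurableX.
by apply/seteqP; split=> -[u v] /= [-> ->].
Qed.

Section countable_partition.
Context (R : realType) (dT : measure_display) (T : measurableType dT)
  (P : probability T R) (X : {RV P >-> (nat * nat)%type}).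

Lemma measurable_RV_nat_nat (A : set (nat * nat)) : measurable (X @^-1` A).
Proof.
rewrite -[X in measurable X]setTI.
by apply: (measurable_funP X) => //; exact: measurable_nat_nat.
Qed.

Let F (i : nat) : set T := X @^-1` [set x : nat * nat | choice.pickle x = i].

Let mF i : measurable (F i). Proof. exact: measurable_RV_nat_nat. Qed.

Let UF : \bigcup_i F i = setT.
Proof. by apply/seteqP; split => // w _; exists (choice.pickle (X w)). Qed.

Let tF : trivIset setT F.
Proof. by apply/trivIsetP => i j _ _ ij; apply/seteqP; split => // w [/= ei ej]; move/eqP: ij; apply; rewrite -ei -ej. Qed.

(** Conditioning on the value of a variable with countably many values. *)
Lemma ge0_integral_countable_eq (f g : T -> \bar R) :
  measurable_fun setT f -> measurable_fun setT g ->
  (forall w, (0 <= f w)%E) -> (forall w, (0 <= g w)%E) ->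
  (forall x, (\int[P]_(w in X @^-1` [set x]) f w =
     \int[P]_(w in X @^-1` [set x]) g w)%E) ->
  (\int[P]_w f w = \int[P]_w g w)%E.
Proof.
move=> mf mg f0 g0 fg.
rewrite -UF !ge0_integral_bigcup//; [|by rewrite UF..].
apply: eq_eseriesr => i _.
have [[x xi]|nx] := pselect (exists x : nat * nat, choice.pickle x = i).
  rewrite (_ : F i = X @^-1` [set x]) ?fg//.
  apply/seteqP; split => w; last by rewrite /F /= => ->.
  by rewrite /F /= -xi => /(pcan_inj choice.pickleK).
rewrite (_ : F i = set0) ?integral_set0//.
by apply/seteqP; split => // w /= h; case: nx; exists (X w).
Qed.

Lemma measure_countable_eq (E E' : set T) (r : R) : 0 <= r ->
  measurable E -> measurable E' ->
  (forall x, (P (E `&` X @^-1` [set x]) = r%:E * P (E' `&` X @^-1` [set x]))%E) ->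
  (P E = r%:E * P E')%E.
Proof.
move=> r0 mE mE' h.
have mX x := measurable_RV_nat_nat [set x].
have := ge0_integral_countable_eq (fun w => (\1_E w)%:E) (fun w => (r%:E * (\1_E' w)%:E)%E).
rewrite ge0_integralZl//; last by apply/measurable_EFinP.
rewrite !integral_indic// !setIT; apply.
- exact/measurable_EFinP.
- by apply: emeasurable_funM => //; exact/measurable_EFinP.
- by [].
- by move=> w; rewrite mule_ge0.
- move=> x; rewrite ge0_integralZl//.
    by rewrite !integral_indic//; exact: h.
  by apply/measurable_EFinP/measurable_funTS.
Qed.

End countable_partition.

Section one_step.
Context (R : realType) (a b c d alpha beta : nat).
Context (dT : measure_display) (T : measurableType dT) (P : probability T R).
Variable (U : nat -> {RV P >-> (nat * nat)%type}).
Hypothesis HU : is_urn_DT a b c d alpha beta U.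
Hypothesis ac : a <> c.

Lemma urn_kernel_ge0 x y : 0 <= urn_kernel R a b c d x y.
Proof. by rewrite /urn_kernel addr_ge0// !mulr_ge0. Qed.

(** The hypothesis on U fixes the whole history up to time n.  Its coordinates
    are forgotten one at a time, from time 0 on, by summing over their
    values. *)
Lemma urn_DT_transition n x y :
  (P ([set w | U n.+1 w = y] `&` [set w | U n w = x]) =
   (urn_kernel R a b c d x y)%:E * P [set w | U n w = x])%E.
Proof.
have mA k h : measurable [set w | forall j, (k <= j <= n)%N -> U j w = h j].
  rewrite (_ : [set _ | _] = \bigcap_(j in [set j | (k <= j <= n)%N]) (U j @^-1` [set h j])).
    apply: bigcap_measurableType.
    by move=> j _; exact: measurable_RV_nat_nat.
  by apply/seteqP; split => w /= H j; exact: H.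
have key k : (k <= n)%N -> forall h : nat -> nat * nat,
  (P ([set w | U n.+1 w = y] `&` [set w | forall j, (k <= j <= n)%N -> U j w = h j]) =
  (urn_kernel R a b c d (h n) y)%:E * P [set w | forall j, (k <= j <= n)%N -> U j w = h j])%E.
  elim: k => [_ h|k IH kn h].
    have := HU.2 n h y; rewrite muleC => <-; congr (P _).
    by apply/seteqP; split => w /= [h1 h2]; split => //.
  apply: (measure_countable_eq _ _ _ P (U k)) => //.
  - exact: urn_kernel_ge0.
  - by apply: measurableI => //; exact: (measurable_RV_nat_nat _ _ _ _ (U n.+1) [set y]).
  move=> z; have := IH (ltnW kn) (fun j => if j == k then z else h j).
  rewrite gtn_eqF// => e.
  have e' : [set w | forall j, (k < j <= n)%N -> U j w = h j] `&` (U k @^-1` [set z])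
    = [set w | forall j, (k <= j <= n)%N -> U j w = if j == k then z else h j].
    apply/seteqP; split => w /=.
      move=> [h1 h2] j /andP[kj jn]; case: eqVneq => [->//|jk].
      by apply: h1; rewrite jn andbT ltn_neqAle eq_sym jk.
    move=> H; split; last by have := H k; rewrite leqnn ltnW// eqxx; apply.
    by move=> j /andP[kj jn]; have := H j; rewrite ltnW// jn gtn_eqF//; apply.
  by rewrite -setIA e' e.
have := key n (leqnn n) (fun=> x).
rewrite (_ : [set w | forall j, _] = [set w | U n w = x])//.
apply/seteqP; split => w /=; first by apply; rewrite leqnn.
by move=> e j /andP[h1 h2]; rewrite (_ : j = n)//; apply/eqP; rewrite eqn_leq h1 h2.
Qed.

(** The Markov property at one time.  When the urn is not empty the kernel has
    total mass 1, so that given U_n = x, the two successors of x carry all the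
    probability.  The empty urn has zero kernel, hence probability zero. *)
Lemma urn_DT_expectation n (f : nat * nat -> \bar R) :
  (forall x, (0 <= f x)%E) ->
  (\int[P]_w f (U n.+1 w) = \int[P]_w
     (((U n w).1%:R / ((U n w).1 + (U n w).2)%:R)%:E * f ((U n w).1 + a, (U n w).2 + b)%N +
     ((U n w).2%:R / ((U n w).1 + (U n w).2)%:R)%:E * f ((U n w).1 + c, (U n w).2 + d)%N))%E.
Proof.
move=> f0.
have mf (g : nat * nat -> \bar R) k : measurable_fun setT (fun w => g (U k w)).
  apply: (measurableT_comp (f := g)) => //.
  by move=> _ Y mY; exact: measurable_nat_nat.
pose K x := ((x.1%:R / (x.1 + x.2)%:R)%:E * f (x.1 + a, x.2 + b)%N +
     (x.2%:R / (x.1 + x.2)%:R)%:E * f (x.1 + c, x.2 + d)%N)%E.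
have K0 x : (0 <= K x)%E by rewrite adde_ge0// mule_ge0// lee_fin.
apply: (ge0_integral_countable_eq _ _ _ _ (U n) _ (fun w => K (U n w))) => //.
move=> x.
have mx : measurable (U n @^-1` [set x]) by exact: measurable_RV_nat_nat.
rewrite [RHS](_ : _ = K x * P (U n @^-1` [set x]))%E; last first.
  rewrite -integral_cst//; apply: eq_integral => w; by rewrite inE /= => ->.
pose y1 := (x.1 + a, x.2 + b)%N; pose y2 := (x.1 + c, x.2 + d)%N.
pose D y := [set w | U n.+1 w = y] `&` [set w | U n w = x].
have mD y : measurable (D y).
  apply: measurableI; [exact: (measurable_RV_nat_nat _ _ _ _ (U n.+1) [set y])|].
  exact: mx.
have y12 : y1 <> y2 by move=> [/eqP]; rewrite eqn_add2l => /eqP.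
have DI y : (\int[P]_(w in D y) f (U n.+1 w) = f y * P (D y))%E.
  rewrite -integral_cst//; apply: eq_integral => w; by rewrite inE /= => -[->].
have [x0|x0] := eqVneq (x.1 + x.2)%N 0%N.
  have Px0 : P (U n @^-1` [set x]) = 0%E.
    rewrite -[RHS](mul0e (P setT)).
    apply: (measure_countable_eq _ _ _ P (U n.+1)) => // y.
    rewrite setIC mul0e; apply: etrans (urn_DT_transition n x y) _.
    by rewrite /urn_kernel x0 invr0 !mulr0 !mul0r addr0 mul0e.
  by rewrite Px0 mule0 null_set_integral//; exact: measurable_funTS (mf f _).
pose N := (U n @^-1` [set x]) `\` (D y1 `|` D y2).
have mN : measurable N by apply: measurableD => //; exact: measurableU.
have dD : [disjoint D y1 & D y2].
  by apply/disj_setPS => w /= [[e1 _] [e2 _]]; apply: y12; rewrite -e1 -e2.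
have split_x : U n @^-1` [set x] = (D y1 `|` D y2) `|` N.
  rewrite /N setDUK// => w /= [[_ e]|[_ e]]; exact: e.
have PD : (P (D y1) + P (D y2) = P (U n @^-1` [set x]))%E.
  rewrite /D !urn_DT_transition -ge0_muleDl ?lee_fin ?urn_kernel_ge0//.
  rewrite -EFinD (_ : _ + _ = 1) ?mul1e// /urn_kernel -/y1 -/y2 !eqxx.
  have /eqP/negbTE y12f := y12; rewrite y12f eq_sym y12f.
  rewrite !mulr1 !mulr0 addr0 add0r -mulrDl -natrD divff// pnatr_eq0//.
have PN : P N = 0%E.
  rewrite /N measureD//; [|exact: measurableU|by rewrite ltey_eq fin_num_measure].
  rewrite setIidr; last by move=> w [[_ e]|[_ e]]; exact: e.
  rewrite measureU//; last exact/disj_set2P.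
  by rewrite PD subee// fin_num_measure.
rewrite [in LHS]split_x ge0_integral_setU//; [|exact: measurableU|exact: measurable_funTS (mf f _)|]; last first.
  by apply/disj_setPS; rewrite setDIK.
rewrite ge0_integral_setU//; [|exact: measurable_funTS (mf f _)].
rewrite [X in (_ + X)%E](null_set_integral mN _ PN)//; last exact: measurable_funTS (mf f _).
rewrite adde0 !DI /K ge0_muleDl ?mule_ge0 ?lee_fin//.
have /eqP/negbTE y12f := y12.
rewrite /D !urn_DT_transition /urn_kernel -/y1 -/y2 !eqxx y12f eq_sym y12f.
by rewrite !mulr1 !mulr0 addr0 add0r !muleA ![(f _ * _)%E]muleC.
Qed.

End one_step.

(** * Exponential moments of the discrete time urn *)

(** From exp(- y) >= 1 - y: exp(y) is at most 1 / (1 - y), which is below the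
    quadratic polynomial when y <= 1 / 2. *)
Lemma expR_le_quad (R : realType) (y : R) : y <= 1 / 2 ->
  expR y <= 1 + y + 2 * y ^+ 2.
Proof.
move=> y2; have h : 0 < 1 - y by lra.
have h1 : (1 - y) * expR y <= 1.
  have := expR_ge1Dx (- y); rewrite -(ler_pM2r (expR_gt0 y)) -expRD addNr expR0.
  by [].
rewrite -(ler_pM2l h); apply: le_trans h1 _.
have -> : (1 - y) * (1 + y + 2 * y ^+ 2) = 1 + y ^+ 2 * (1 - 2 * y) by ring.
by rewrite lerDl mulr_ge0 ?sqr_ge0//; lra.
Qed.

Section large_urn_arithmetic.
Context (R : realType) (a b c d : nat).
Hypothesis hurn : large_urn R a b c d.
Local Notation S := (urn_S R a b).
Local Notation m := (urn_m R a c).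

Lemma urn_bc_gt0 : (0 < b)%N /\ (0 < c)%N.
Proof. by have [_ + _] := hurn; rewrite muln_eq0 negb_or -!lt0n => /andP. Qed.

Lemma urn_S_gt0 : 0 < S.
Proof. by rewrite ltr0n; have [b0 _] := urn_bc_gt0; rewrite addn_gt0 b0 orbT. Qed.

Lemma urn_m_gtS : S < 2 * m.
Proof.
have [_ _] := hurn; rewrite /urn_sigma ltr_pdivlMr ?urn_S_gt0//; lra.
Qed.

Lemma urn_m_gt0 : 0 < m.
Proof. have := urn_m_gtS; have := urn_S_gt0; lra. Qed.

Lemma urn_balance : (a + b)%:R = (c + d)%:R :> R.
Proof. by have [-> _ _] := hurn. Qed.

Lemma urn_mE : m = d%:R - b%:R.
Proof. have := urn_balance; rewrite /urn_m !natrD; lra. Qed.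

Lemma urn_ac : a <> c.
Proof. by move=> e; have := urn_m_gt0; rewrite /urn_m e subrr ltxx. Qed.

Lemma u2D x y : u2 R a b c (x.1 + y.1, x.2 + y.2)%N = u2 R a b c x + u2 R a b c y.
Proof. by rewrite /u2 /= !natrD -mulrDl; congr (_ / _); ring. Qed.

(** The function u2 is an eigenvector of the replacement matrix for the
    eigenvalue m: a draw adds m times the value of u2 on the drawn ball. *)
Lemma u2_red_draw : u2 R a b c (a, b) = m * u2 R a b c (1, 0)%N.
Proof.
by rewrite /u2 /urn_m /= [RHS]mulrA; congr (_ / _); ring.
Qed.

Lemma u2_black_draw : u2 R a b c (c, d) = m * u2 R a b c (0, 1)%N.
Proof.
by rewrite urn_mE /u2 /= [RHS]mulrA; congr (_ / _); ring.
Qed.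

Lemma u2_red : u2 R a b c (1, 0)%N = b%:R / S.
Proof. by rewrite /u2 /= mulr1 mulr0 subr0. Qed.

Lemma u2_black : u2 R a b c (0, 1)%N = - (c%:R / S).
Proof. by rewrite /u2 /= mulr1 mulr0 sub0r mulNr. Qed.

Lemma norm_u2_red : `|u2 R a b c (1, 0)%N| <= 1.
Proof.
rewrite u2_red ger0_norm ?divr_ge0 ?(ltW urn_S_gt0)//.
by rewrite ler_pdivrMr ?urn_S_gt0// mul1r ler_nat leq_addl.
Qed.

Lemma norm_u2_black : `|u2 R a b c (0, 1)%N| <= 1.
Proof.
rewrite u2_black normrN ger0_norm ?divr_ge0 ?(ltW urn_S_gt0)//.
by rewrite ler_pdivrMr ?urn_S_gt0// mul1r /urn_S urn_balance ler_nat leq_addr.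
Qed.

Lemma u2E x : u2 R a b c x = x.1%:R * u2 R a b c (1, 0)%N + x.2%:R * u2 R a b c (0, 1)%N.
Proof. by rewrite u2_red u2_black /u2 mulrN !mulrA -mulNr -mulrDl; congr (_ / _); ring. Qed.

End large_urn_arithmetic.

Section discrete_time_bound.
Context (R : realType) (a b c d alpha beta : nat).
Hypothesis hurn : large_urn R a b c d.
Hypothesis h0 : (alpha, beta) <> (0%N, 0%N).
Local Notation S := (urn_S R a b).
Local Notation m := (urn_m R a c).
Local Notation sigma := (urn_sigma R a b c).
Local Notation u := (u2 R a b c).

Definition urn_total n : nat := (alpha + beta + (a + b) * n)%N.

(** The mean of u2 is multiplied by 1 + m / T_k at draw k, so u2(U_n) / growth n
    is a martingale. *)
Definition growth n : R := \prod_(k < n) (1 + m / (urn_total k)%:R).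

Let tot0_gt0 : (0 < alpha + beta)%N.
Proof. by move: h0; case: alpha => [|//]; case: beta. Qed.

Lemma urn_total_gt0 n : 0 < (urn_total n)%:R :> R.
Proof. by rewrite ltr0n addn_gt0 tot0_gt0. Qed.

Let m0 := urn_m_gt0 R a b c d hurn.
Let S0 := urn_S_gt0 R a b c d hurn.

Let q_ge1 n : 1 <= 1 + m / (urn_total n)%:R.
Proof. by rewrite lerDl divr_ge0 ?ltW// urn_total_gt0. Qed.

Lemma growth0 : growth 0 = 1. Proof. by rewrite /growth big_ord0. Qed.

Lemma growthS n : growth n.+1 = growth n * (1 + m / (urn_total n)%:R).
Proof. by rewrite /growth big_ord_recr. Qed.

Lemma growth_ge1 n : 1 <= growth n.
Proof.
elim: n => [|n IH]; first by rewrite growth0.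
by rewrite growthS -[leLHS]mul1r ler_pM.
Qed.

(** The k-th factor is at most exp(sigma / k), because T_k >= S k, and
    1 / k <= ln k - ln (k - 1). *)
Lemma growth_le n : growth n.+1 <= growth 2 * n.+1%:R `^ sigma.
Proof.
have main k : growth k.+2 <= growth 2 * k.+1%:R `^ sigma.
  elim: k => [|k IH]; first by rewrite powR1 mulr1.
  rewrite growthS.
  have e1 : 1 + m / (urn_total k.+2)%:R <= expR (sigma / k.+2%:R).
    apply: le_trans (expR_ge1Dx _); rewrite lerD2l /urn_sigma -mulrA -invfM.
    rewrite ler_pM2l// lef_pV2 ?posrE ?mulr_gt0 ?urn_total_gt0//.
    by rewrite /urn_S -natrM ler_nat /urn_total leq_addl.
  have e2 : k.+1%:R `^ sigma * expR (sigma / k.+2%:R) <= k.+2%:R `^ sigma.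
    rewrite /powR !pnatr_eq0/= -expRD ler_expR -mulrDr.
    rewrite ler_wpM2l ?divr_ge0 ?(ltW m0) ?(ltW S0)//.
    have := @le_ln1Dx R (- k.+2%:R^-1).
    have -> : 1 + - k.+2%:R^-1 = k.+1%:R / k.+2%:R :> R.
      have z0 : k.+2%:R != 0 :> R by rewrite pnatr_eq0.
      by apply: (mulIf z0); rewrite mulrBl mul1r mulVf// divfK// -(natr1 k.+1) addrK.
    rewrite ln_div ?posrE//; have : - 1 < - k.+2%:R^-1 :> R.
      by rewrite ltrN2 invf_lt1// ltr1n.
    by move=> h /(_ h); rewrite lerBlDr [- _ + _]addrC -lerBrDr.
  apply: le_trans (ler_wpM2l (le_trans ler01 (growth_ge1 2)) e2).
  by rewrite mulrA; apply: ler_pM => //; apply: (le_trans ler01); rewrite ?growth_ge1 ?q_ge1.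
apply: le_trans (main n).
by rewrite [leRHS]growthS -[leLHS]mulr1 ler_wpM2l// (le_trans _ (growth_ge1 _)).
Qed.

(** The value +oo on compositions with a wrong number of balls makes the one
    step bound hold everywhere: no null set has to be discarded. *)
Definition mgf_at n (th : R) (x : nat * nat) : \bar R :=
  if (x.1 + x.2)%N == urn_total n then (expR (th * u x))%:E else +oo%E.

Let C := 2 * m ^+ 2.

(** Given the composition x, the increment of u2 has mean m u2(x) / T_n and is
    at most m in absolute value.  The mean changes theta into
    theta (1 + m / T_n) and the quadratic bound on the exponential gives the
    factor. *)
Lemma mgf_step n th x : `|th| * m <= 1 / 2 ->
  ((x.1%:R / (x.1 + x.2)%:R)%:E * mgf_at n.+1 th (x.1 + a, x.2 + b)%N +
   (x.2%:R / (x.1 + x.2)%:R)%:E * mgf_at n.+1 th (x.1 + c, x.2 + d)%N <=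
   (expR (C * th ^+ 2))%:E * mgf_at n (th * (1 + m / (urn_total n)%:R)) x)%E.
Proof.
move=> th2; rewrite /mgf_at; have [xn|_] := eqVneq (x.1 + x.2)%N (urn_total n); last first.
  by rewrite gt0_muley ?lte_fin ?expR_gt0// leey.
have [Sbal _ _] := hurn.
rewrite (_ : (_ == urn_total n.+1) = true); last first.
  by apply/eqP; rewrite /= addnACA xn /urn_total mulnS; lia.
rewrite (_ : (_ == urn_total n.+1) = true); last first.
  by apply/eqP; rewrite /= addnACA xn /urn_total mulnS Sbal; lia.
rewrite -!EFinM -EFinD lee_fin xn.
have T0 := urn_total_gt0 n; set N : R := (urn_total n)%:R in T0 *.
have xN : x.1%:R + x.2%:R = N by rewrite -natrD xn.
rewrite !(u2D R a b c x (_, _)) u2_red_draw (u2_black_draw R a b c d)//.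
set ur := u (1, 0)%N; set ub := u (0, 1)%N.
have ur0 : `|ur| <= 1 := norm_u2_red R a b c d hurn.
have ub0 : `|ub| <= 1 := norm_u2_black R a b c d hurn.
have ur1 : `|th * (m * ur)| <= 1 / 2.
  rewrite (normrM th) (normrM m) (ger0_norm (ltW m0)) mulrA; apply: le_trans th2.
  by rewrite ler_piMr ?mulr_ge0 ?(ltW m0)//.
have ub1 : `|th * (m * ub)| <= 1 / 2.
  rewrite (normrM th) (normrM m) (ger0_norm (ltW m0)) mulrA; apply: le_trans th2.
  by rewrite ler_piMr ?mulr_ge0 ?(ltW m0)//.
have B v : `|th * (m * v)| <= 1 / 2 -> `|v| <= 1 ->
    expR (th * (m * v)) <= 1 + th * (m * v) + C * th ^+ 2.
  move=> h v1; apply: le_trans (expR_le_quad _ _ (le_trans (ler_norm _) h)) _.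
  rewrite lerD2l /C.
  rewrite (_ : 2 * _ = 2 * m ^+ 2 * th ^+ 2 * v ^+ 2); last by ring.
  apply: ler_piMr; first by rewrite mulr_ge0 ?sqr_ge0// mulr_ge0 ?sqr_ge0.
  by rewrite -[v ^+ 2]real_normK ?num_real// expr_le1.
have -> : expR (C * th ^+ 2) * expR (th * (1 + m / N) * u x) =
   expR (th * u x) * expR (th * m * (x.1%:R / N * ur + x.2%:R / N * ub) + C * th ^+ 2).
  rewrite -!expRD; congr expR; rewrite (u2E R a b c x) -/ur -/ub.
  by field; rewrite gt_eqF.
have e v : expR (th * (u x + v)) = expR (th * u x) * expR (th * v).
  by rewrite mulrDr expRD.
rewrite !e !(mulrCA _ (expR (th * u x))) -mulrDr ler_pM2l ?expR_gt0//.
apply: le_trans (expR_ge1Dx _).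
have p0 : 0 <= x.1%:R / N by rewrite divr_ge0// ltW.
have q0 : 0 <= x.2%:R / N by rewrite divr_ge0// ltW.
apply: le_trans (lerD (ler_wpM2l p0 (B _ ur1 ur0)) (ler_wpM2l q0 (B _ ub1 ub0))) _.
have -> : x.2%:R / N = 1 - x.1%:R / N.
  by rewrite -xN; field; rewrite xN gt_eqF.
by rewrite le_eqVlt; apply/orP; left; apply/eqP; ring.
Qed.

End discrete_time_bound.

Section discrete_time_limit.
Context (R : realType) (a b c d alpha beta : nat).
Hypothesis hurn : large_urn R a b c d.
Hypothesis h0 : (alpha, beta) <> (0%N, 0%N).
Local Notation S := (urn_S R a b).
Local Notation m := (urn_m R a c).
Local Notation sigma := (urn_sigma R a b c).
Local Notation u := (u2 R a b c).
Local Notation T_ n := ((urn_total a b alpha beta n)%:R : R).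
Local Notation g_ n := (growth R a b c alpha beta n).
Context (dT : measure_display) (T : measurableType dT) (P : probability T R).
Variable (U : nat -> {RV P >-> (nat * nat)%type}).
Hypothesis HU : is_urn_DT a b c d alpha beta U.

Let m0 := urn_m_gt0 R a b c d hurn.
Let S0 := urn_S_gt0 R a b c d hurn.
Let T0 n : 0 < T_ n := urn_total_gt0 R a b alpha beta h0 n.

(** The subtracted T_n / T_0 makes the exponent at time 0 linear in theta; its
    increments pay for the factor lost at each draw. *)
Definition mgf_exponent n (th : R) : R :=
  `|u (alpha, beta)| * `|th| * g_ n +
  2 * m ^+ 2 * T_ 0 / (2 * m - S) * th ^+ 2 * (g_ n ^+ 2 - T_ n / T_ 0).

Let measurable_natfun (f : nat * nat -> \bar R) n :
  measurable_fun setT (fun w => f (U n w)).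
Proof.
apply: (measurableT_comp (f := f)) => //.
by move=> _ Y mY; exact: measurable_nat_nat.
Qed.

Lemma mgf_at_ge0 n th x : (0 <= mgf_at R a b c alpha beta n th x)%E.
Proof. by rewrite /mgf_at; case: ifP => // _; rewrite lee_fin expR_ge0. Qed.

Lemma mgf_bound n th : `|th| * g_ n * m <= 1 / 2 ->
  (\int[P]_w mgf_at R a b c alpha beta n th (U n w) <=
   (expR (mgf_exponent n th))%:E)%E.
Proof.
have S2m := urn_m_gtS R a b c d hurn.
elim: n th => [|n IH] th hth.
  pose x0 := (alpha, beta).
  have x0E : mgf_at R a b c alpha beta 0 th x0 = (expR (th * u x0))%:E.
    by rewrite /mgf_at /urn_total muln0 addn0 eqxx.
  have -> : (\int[P]_w mgf_at R a b c alpha beta 0 th (U 0%N w) =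
      \int[P]_w (cst (expR (th * u x0))%:E w))%E.
    apply: ge0_ae_eq_integral => //.
    - by move=> w _; exact: mgf_at_ge0.
    - by move=> w _; rewrite /= lee_fin expR_ge0.
    - have mE : measurable [set w | U 0%N w = x0].
        exact: (measurable_RV_nat_nat _ _ _ _ (U 0%N) [set x0]).
      exists (~` [set w | U 0%N w = x0]); split; first exact: measurableC.
        by apply: etrans (probability_setC P mE) _; rewrite [X in (1 - X)%E]HU.1 subee.
      by move=> w /= H e; apply: H => _; rewrite e x0E.
  rewrite integral_cst// [X in (_ * X)%E](probability_setT P) mule1 lee_fin ler_expR.
  rewrite /mgf_exponent growth0 mulr1 expr1n divff ?gt_eqF// subrr mulr0 addr0.
  by rewrite mulrC -normrM ler_norm.
rewrite (urn_DT_expectation _ a b c d alpha beta)//; [|exact: urn_ac hurn|]; last first.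
  by move=> x; exact: mgf_at_ge0.
set q := 1 + m / T_ n.
have q1 : 1 <= q by rewrite lerDl divr_ge0// ltW.
have g1 := growth_ge1 R a b c d alpha beta hurn h0 n.
have hth1 : `|th| * m <= 1 / 2.
  apply: le_trans hth; rewrite ler_pM2r// ler_peMr//.
  exact: (growth_ge1 R a b c d alpha beta hurn h0 n.+1).
have hthq : `|th * q| * g_ n * m <= 1 / 2.
  apply: le_trans hth; rewrite growthS -/q normrM (ger0_norm (le_trans ler01 q1)).
  by rewrite [g_ n * q]mulrC mulrA.
apply: (@le_trans _ _ (\int[P]_w ((expR (2 * m ^+ 2 * th ^+ 2))%:E *
   mgf_at R a b c alpha beta n (th * q) (U n w)))%E).
  apply: ge0_le_integral => //.
  - move=> w _; rewrite adde_ge0// mule_ge0// ?mgf_at_ge0// lee_fin//.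
  - exact: (measurable_natfun (fun x => ((x.1%:R / (x.1 + x.2)%:R)%:E * mgf_at R a b c alpha beta n.+1 th (x.1 + a, x.2 + b)%N +
     (x.2%:R / (x.1 + x.2)%:R)%:E * mgf_at R a b c alpha beta n.+1 th (x.1 + c, x.2 + d)%N)%E)).
  - exact: (measurable_natfun (fun x => (expR (2 * m ^+ 2 * th ^+ 2))%:E *
       mgf_at R a b c alpha beta n (th * q) x)%E).
  - by move=> w _; exact: mgf_step.
rewrite ge0_integralZl//; last first.
  by move=> w _; exact: mgf_at_ge0.
apply: le_trans (lee_wpmul2l _ (IH _ hthq)) _; first by rewrite lee_fin expR_ge0.
rewrite -EFinM -expRD lee_fin ler_expR /mgf_exponent growthS -/q.
have Tn0 := T0 n; have T00 := T0 0%N.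
have -> : T_ n.+1 = T_ n + S by rewrite /urn_S -natrD; congr (_%:R); rewrite /urn_total mulnS; lia.
rewrite (normrM th q) (ger0_norm (le_trans ler01 q1)).
set Cc := 2 * m ^+ 2.
set D := Cc * T_ 0 / (2 * m - S).
have D0 : 0 < D.
  by rewrite divr_gt0 ?subr_gt0// mulr_gt0// mulr_gt0// exprn_gt0.
have key : Cc * th ^+ 2 <= D * th ^+ 2 * ((T_ n * q ^+ 2 - T_ n - S) / T_ 0).
  have -> : D * th ^+ 2 * ((T_ n * q ^+ 2 - T_ n - S) / T_ 0) =
     Cc * th ^+ 2 * ((T_ n * q ^+ 2 - T_ n - S) / (2 * m - S)).
    have fld (z y x k t : R) : z != 0 -> y != 0 -> k * z / y * t * (x / z) = k * t * (x / y).
      by move=> z0 y0; field; apply/andP.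
    by rewrite /D fld// gt_eqF// subr_gt0.
  rewrite ler_peMr//; first by rewrite mulr_ge0 ?sqr_ge0// mulr_ge0 ?sqr_ge0.
  rewrite ler_pdivlMr ?subr_gt0// mul1r.
  have -> : T_ n * q ^+ 2 - T_ n - S = 2 * m - S + m ^+ 2 / T_ n.
    have fld (x y z : R) : x != 0 -> x * (1 + y / x) ^+ 2 - x - z = 2 * y - z + y ^+ 2 / x.
      by move=> x0; field.
    by rewrite /q fld// gt_eqF.
  by rewrite lerDl divr_ge0 ?sqr_ge0// ltW.
have -> : D * th ^+ 2 * ((g_ n * q) ^+ 2 - (T_ n + S) / T_ 0) =
   D * (th * q) ^+ 2 * (g_ n ^+ 2 - T_ n / T_ 0) +
   D * th ^+ 2 * ((T_ n * q ^+ 2 - T_ n - S) / T_ 0).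
  have fld (k t g p x y z : R) : z != 0 ->
    k * t ^+ 2 * ((g * p) ^+ 2 - (x + y) / z) =
    k * (t * p) ^+ 2 * (g ^+ 2 - x / z) + k * t ^+ 2 * ((x * p ^+ 2 - x - y) / z).
    by move=> z0; field.
  by rewrite fld// gt_eqF.
have -> : `|u (alpha, beta)| * `|th| * (g_ n * q) = `|u (alpha, beta)| * (`|th| * q) * g_ n by ring.
rewrite [leLHS]addrC -[leLHS]addrA lerD2l. by rewrite lerD2l.
Qed.

(** The bound is used at theta = e / n ^ sigma with |e| = s: growth n is at most
    B n ^ sigma, and s is chosen so that s B m = 1 / 2. *)
Theorem urn_DT_moment_determined (W : {RV P >-> R}) :
  is_W_DT a b c U W -> moment_determined (distribution P W).
Proof.
move=> HW.
have S2m := urn_m_gtS R a b c d hurn.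
pose B := g_ 2; pose s := (2 * B * m)^-1.
have B0 : 0 < B by apply: lt_le_trans (growth_ge1 R a b c d alpha beta hurn h0 2).
have s0 : 0 < s by rewrite invr_gt0 !mulr_gt0.
pose C := `|u (alpha, beta)| * (s * B) +
  2 * m ^+ 2 * T_ 0 / (2 * m - S) * (s * B) ^+ 2.
have bnd e : `|e| = s -> (\int[P]_w (expR (e * W w))%:E <= (expR C)%:E)%E.
  move=> es.
  pose X n w : R := u (U n.+1 w) / n.+1%:R `^ sigma.
  apply: (fatou_le _ _ _ _ (fun n w => (expR (e * X n w))%:E)).
  - move=> n; exact: (measurable_natfun (fun x => (expR (e * (u x / n.+1%:R `^ sigma)))%:E)).
  - apply: (measurableT_comp (measurable_expRM e)); exact: measurable_funP.
  - by move=> n w; rewrite lee_fin expR_ge0.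
  - by move=> w; rewrite lee_fin expR_ge0.
  - apply: filterS HW => w Hw; apply: cvg_EFin; first exact: nearW.
    apply: continuous_cvg; first exact: continuous_expR.
    apply: cvgMr; rewrite /X.
    by have := Hw; rewrite -(cvg_shiftS (fun n => u (U n w) / n%:R `^ sigma)).
  - move=> n; pose th := e / n.+1%:R `^ sigma.
    have p0 : 0 < n.+1%:R `^ sigma :> R by rewrite powR_gt0.
    have thg : `|th| * g_ n.+1 <= s * B.
      rewrite /th normrM es normfV (gtr0_norm p0) -mulrA ler_pM2l//.
      rewrite mulrC ler_pdivrMr//; exact: growth_le hurn h0 n.
    have hth : `|th| * g_ n.+1 * m <= 1 / 2.
      apply: le_trans (_ : s * B * m <= _); first by rewrite ler_pM2r.
      have fld (x y : R) : x != 0 -> y != 0 -> (2 * x * y)^-1 * x * y = 1 / 2.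
        by move=> x0 y0; field; apply/andP.
      by rewrite /s fld// gt_eqF.
    apply: le_trans (le_trans (mgf_bound n.+1 th hth) _); last first.
      rewrite lee_fin ler_expR /mgf_exponent /C; apply: lerD.
        by rewrite -mulrA ler_wpM2l.
      rewrite -[leLHS]mulrA ler_wpM2l//.
        by rewrite divr_ge0 ?subr_ge0 ?(ltW S2m)// mulr_ge0 ?(ltW (T0 0))// mulr_ge0 ?sqr_ge0.
      apply: (@le_trans _ _ ((`|th| * g_ n.+1) ^+ 2)).
        rewrite [(`|th| * _) ^+ 2]exprMn -[th ^+ 2]real_normK ?num_real// ler_wpM2l ?sqr_ge0//.
        by rewrite gerBl divr_ge0// ltW.
      by rewrite ler_pXn2r ?nnegrE ?mulr_ge0 ?(ltW s0) ?(ltW B0)// (le_trans ler01)// (growth_ge1 R a b c d alpha beta hurn h0).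
    apply: ge0_le_integral => //.
    - exact: (measurable_natfun (fun x => (expR (e * (u x / n.+1%:R `^ sigma)))%:E)).
    - move=> w _; rewrite /mgf_at; case: ifP => _; last by rewrite leey.
      by rewrite /X /th mulrA mulrAC lexx.
apply: (distribution_moment_determined _ _ _ _ _ s) => //.
  by apply: le_lt_trans (bnd s _) _; rewrite ?ltry// gtr0_norm.
by apply: le_lt_trans (bnd (- s) _) _; rewrite ?ltry// normrN gtr0_norm.
Qed.

End discrete_time_limit.

(** * Independence of the information carried by disjoint sets of clocks *)

Section independent_pair.
Context (R : realType) (d d1 d2 : measure_display) (T : measurableType d)
  (T1 : measurableType d1) (T2 : measurableType d2) (P : probability T R).
Variables (X : {mfun T >-> T1}) (Y : {mfun T >-> T2}).
Hypothesis XY : forall A B, measurable A -> measurable B ->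
  P (X @^-1` A `&` Y @^-1` B) = (P (X @^-1` A) * P (Y @^-1` B))%E.

Let XYfun (w : T) : T1 * T2 := (X w, Y w).

Let mXY : measurable_fun setT XYfun.
Proof. by apply/measurable_fun_pairP; split; exact: measurable_funP. Qed.

HB.instance Definition _ := isMeasurableFun.Build _ _ _ _ XYfun mXY.

(** The law of the pair is the product law, as both agree on rectangles. *)
Lemma integral_independent (h : T1 * T2 -> \bar R) :
  measurable_fun setT h -> (forall z, (0 <= h z)%E) ->
  (\int[P]_w h (X w, Y w) = \int[P]_w \int[P]_v h (X w, Y v))%E.
Proof.
move=> mh h0.
transitivity (\int[distribution P XYfun]_z h z)%E.
  by rewrite ge0_integral_distribution.
transitivity (\int[(distribution P X \x distribution P Y)%E]_z h z)%E.
  apply: eq_measure_integral => A mA _.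
  by apply/esym; apply: (@product_measure_unique _ _ _ _ _ (distribution P X) (distribution P Y)) => // A1 A2 mA1 mA2; exact: XY.
rewrite fubini_tonelli1//.
rewrite ge0_integral_distribution//; last first.
- by move=> x; exact: integral_ge0.
- exact: measurable_fun_fubini_tonelli_F.
apply: eq_integral => w _ /=; rewrite /fubini_F.
rewrite ge0_integral_distribution//.
by apply: measurableT_comp => //; exact: measurable_pair1.
Qed.

End independent_pair.

Section clock_sigma_algebra.
Context (R : realType) (d : measure_display) (T : measurableType d)
  (P : probability T R) (I : eqType) (X : I -> {RV P >-> R}).

(** The events that constrain finitely many of the clocks with labels in L; a
    pi-system. *)
Definition cylinder (L : set I) : set (set T) :=
  [set E | exists (s : seq I) (A : I -> set R),
     [/\ uniq s, (forall i, i \in s -> L i), (forall i, measurable (A i)) &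
      E = [set w | forall i, i \in s -> A i (X i w)]]].

(** The sample space with the sigma-algebra of the events that are known from
    the clocks in L.  As a measurable type it lets joint measurability in a
    time and in these clocks be stated with product spaces. *)
Definition info (L : set I) := g_sigma_algebraType (cylinder L).

Lemma cylinder_setI L : setI_closed (cylinder L).
Proof.
move=> _ _ [s [A [us sL mA ->]]] [s' [A' [us' sL' mA' ->]]].
pose r (t : seq I) (B : I -> set R) i := if i \in t then B i else setT.
exists (undup (s ++ s')), (fun i => r s A i `&` r s' A' i).
split; first exact: undup_uniq.
- by move=> i; rewrite mem_undup mem_cat => /orP[/sL|/sL'].
- by move=> i; apply: measurableI; rewrite /r; case: ifP.
- apply/seteqP; split => w /=.
    move=> [h h'] i; rewrite mem_undup mem_cat /r => _.
    by split; case: ifPn => //; [exact: h|exact: h'].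
  move=> h; split => i si; have := h i; rewrite mem_undup mem_cat si ?orbT => /(_ isT).
    by rewrite /r si => -[].
  by rewrite /r si => -[].
Qed.

Lemma cylinderT L : cylinder L setT.
Proof. by exists [::], (fun=> setT); split => //; apply/seteqP; split. Qed.

Lemma cylinderS L L' : L `<=` L' -> cylinder L `<=` cylinder L'.
Proof.
move=> LL' E [s [A [us sL mA ->]]]; exists s, A; split => // i /sL; exact: LL'.
Qed.

Lemma cylinder_measurable L : cylinder L `<=` measurable.
Proof.
move=> _ [s [A [us sL mA ->]]].
rewrite (_ : [set _ | _] = \bigcap_(i in [set` s]) (X i @^-1` A i)).
  apply: fin_bigcap_measurable => // i _.
  by rewrite -[Y in measurable Y]setTI; apply: (measurable_funP (X i)) => //; exact: mA.
by apply/seteqP; split => w /= h i; exact: h.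
Qed.

Lemma info_measurable L : <<s cylinder L >> `<=` measurable.
Proof.
apply: smallest_sub; last exact: cylinder_measurable.
by split => //= [A mA|F mF]; [exact: measurableD|exact: bigcupT_measurable].
Qed.

Definition info_id L (w : T) : info L := w.

Lemma measurable_info_id L : measurable_fun setT (info_id L).
Proof. by move=> _ Y mY; rewrite setTI; exact: (info_measurable L Y mY). Qed.

HB.instance Definition _ L := isMeasurableFun.Build _ _ _ _ (info_id L) (measurable_info_id L).

Lemma measurable_infoS L L' d' (Y : measurableType d') (f : T -> Y) : L `<=` L' ->
  measurable_fun (setT : set (info L)) (f : info L -> Y) ->
  measurable_fun (setT : set (info L')) (f : info L' -> Y).
Proof.
move=> LL' mf _ B mB; have := mf measurableT B mB; rewrite !setTI.
by apply: sub_sigma_algebra2; exact: cylinderS.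
Qed.

Lemma measurable_info L d' (Y : measurableType d') (f : T -> Y) :
  measurable_fun (setT : set (info L)) (f : info L -> Y) ->
  measurable_fun setT f.
Proof. by move=> mf; exact: (measurableT_comp mf (measurable_info_id L)). Qed.

Lemma measurable_clock_info (L : set I) i : L i ->
  measurable_fun (setT : set (info L)) (X i : info L -> R).
Proof.
move=> Li _ B mB; rewrite setTI; apply: sub_sigma_algebra.
exists [:: i], (fun=> B); split => //.
  by move=> j; rewrite inE => /eqP ->.
apply/seteqP; split => w /=; first by move=> h j; rewrite inE => /eqP ->.
by apply; rewrite inE.
Qed.

Hypothesis indep : mutually_independent X.

Lemma cylinder_independent L L' E E' : L `&` L' = set0 ->
  cylinder L E -> cylinder L' E' -> (P (E `&` E') = P E * P E')%E.
Proof.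
move=> LL' [s [A [us sL mA ->]]] [s' [A' [us' sL' mA' ->]]].
have disj i : i \in s -> i \in s' -> False.
  by move=> /sL Li /sL' Li'; have : (L `&` L') i by []; rewrite LL'.
pose B i := if i \in s then A i else A' i.
have := indep (s ++ s') B.
rewrite cat_uniq us us' andbT /=.
have -> : ~~ has (in_mem^~ (mem s)) s'.
  by apply/hasPn => i s'i; apply/negP => si; exact: disj si s'i.
move=> /(_ isT).
have mB i : measurable (B i) by rewrite /B; case: ifP.
move=> /(_ mB); rewrite big_cat /=.
rewrite (eq_big_seq (fun i => P (X i @^-1` A i))); last by move=> i si; rewrite /B si.
rewrite -(indep s A us mA).
rewrite [X in (_ * X)%E](eq_big_seq (fun i => P (X i @^-1` A' i))); last first.
  by move=> i si; rewrite /B; case: ifPn => // /disj /(_ si).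
rewrite -(indep s' A' us' mA') => <-; congr (P _).
apply/seteqP; split => w /=.
  move=> [h h'] i; rewrite mem_cat /B; case: ifPn => [si _|_ /= s'i]; [exact: h|exact: h'].
move=> h; split => i si; have := h i; rewrite mem_cat si ?orbT /B ?si => /(_ isT)//.
by case: ifPn => // /disj /(_ si).
Qed.

(** Independence of the cylinders extends to the generated sigma-algebras, one
    side at a time, by uniqueness of finite measures on a pi-system. *)
Lemma info_independent L L' E E' : L `&` L' = set0 ->
  <<s cylinder L >> E -> <<s cylinder L' >> E' -> (P (E `&` E') = P E * P E')%E.
Proof.
move=> LL' sE sE'.
have ext M (B : set T) : measurable B ->
    (forall A, cylinder M A -> P (A `&` B) = P A * P B)%E ->
    forall A, <<s cylinder M >> A -> (P (A `&` B) = P A * P B)%E.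
  move=> mB h A sA.
  have r0 : (0 <= fine (P B))%R by rewrite fine_ge0.
  have PBE : (fine (P B))%:E = P B by rewrite fineK// fin_num_measure.
  have := @g_sigma_algebra_measure_unique _ R T (cylinder M) (@cylinder_measurable M)
    (fun=> setT) (fun=> cylinderT M) _ (mrestr P mB) (mscale (NngNum r0) P).
  move=> /(_ _ (@cylinder_setI M)) H.
  rewrite -[LHS]/(mrestr P mB A) H//.
  - by transitivity ((fine (P B))%:E * P A)%E; rewrite // PBE muleC.
  - by apply/seteqP; split => // w _; exists 0%N.
  - move=> C mC; transitivity (P (C `&` B)); first by [].
    by transitivity ((fine (P B))%:E * P C)%E; rewrite // PBE muleC h.
  - by move=> k; rewrite ltey_eq fin_num_measure.
have mE' := info_measurable _ _ sE'.
apply: (ext L _ mE' _ _ sE) => A cA; rewrite setIC muleC.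
have mA := cylinder_measurable _ _ cA.
apply: (ext L' _ mA _ _ sE') => A' cA'.
by rewrite setIC muleC (cylinder_independent L L').
Qed.

Lemma integral_info_mul L L' (f g : T -> \bar R) : L `&` L' = set0 ->
  measurable_fun (setT : set (info L)) (f : info L -> \bar R) ->
  measurable_fun (setT : set (info L')) (g : info L' -> \bar R) ->
  (forall w, (0 <= f w)%E) -> (forall w, (0 <= g w)%E) ->
  (\int[P]_w (f w * g w) = (\int[P]_w f w) * (\int[P]_w g w))%E.
Proof.
move=> LL' mf mg f0 g0.
have mf' := measurable_info _ _ _ _ mf; have mg' := measurable_info _ _ _ _ mg.
pose h (z : info L * info L') := (f z.1 * g z.2)%E.
transitivity (\int[P]_w h (info_id L w, info_id L' w))%E; first by [].
rewrite (integral_independent R d _ _ T (info L) (info L') P (info_id L) (info_id L')).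
- rewrite /h /=; under eq_integral do rewrite ge0_integralZl//.
  by rewrite ge0_integralZr// integral_ge0.
- by move=> A B mA mB; exact: (info_independent L L').
- by apply: emeasurable_funM; exact: measurableT_comp.
- by move=> z; exact: mule_ge0.
Qed.

Lemma measurable_integral_info L (h : R -> T -> \bar R) :
  measurable_fun (setT : set (R * info L)) (fun z : R * info L => h z.1 z.2) ->
  (forall x w, (0 <= h x w)%E) ->
  measurable_fun setT (fun x => \int[P]_w h x w)%E.
Proof.
move=> mh h0; pose H (z : R * info L) := h z.1 z.2.
rewrite (_ : (fun x => _) = fubini_F (distribution P (info_id L)) H).
  by apply: measurable_fun_fubini_tonelli_F => // z; exact: h0.
apply/funext => x; rewrite /fubini_F ge0_integral_distribution//; last by move=> y; exact: h0.
by apply: measurableT_comp => //; exact: measurable_pair1.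
Qed.

(** A clock outside L is independent of the information in L, so it can be
    frozen at a value x and integrated last. *)
Lemma integral_clock_info L i (h : R -> T -> \bar R) : ~ L i ->
  measurable_fun (setT : set (R * info L)) (fun z : R * info L => h z.1 z.2) ->
  (forall x w, (0 <= h x w)%E) ->
  (\int[P]_w h (X i w) w =
   \int[distribution P (X i)]_x \int[P]_w h x w)%E.
Proof.
move=> Li mh h0.
pose H (z : R * info L) := h z.1 z.2.
transitivity (\int[P]_w H (X i w, info_id L w))%E; first by [].
rewrite (integral_independent R d _ _ T R (info L) P (X i) (info_id L)) //.
- rewrite ge0_integral_distribution//; last by move=> x; exact: integral_ge0.
  exact: measurable_integral_info mh h0.
- move=> A B mA mB; apply: (info_independent [set i] L) => //.
    by apply/seteqP; split => // j /= [-> Lj]; exact: Li.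
  have := measurable_clock_info [set i] i erefl measurableT A mA.
  by rewrite setTI.
- by move=> z; exact: h0.
Qed.

End clock_sigma_algebra.

Lemma integral_info_prod_le (R : realType) (d : measure_display)
  (T : measurableType d) (P : probability T R) (I : eqType) (X : I -> {RV P >-> R})
  (L : nat -> set I) (f : nat -> T -> R) (B : nat -> R) n :
  mutually_independent X ->
  (forall j k, j <> k -> L j `&` L k = set0) ->
  (forall j, measurable_fun (setT : set (info R d T P I X (L j))) (f j : info R d T P I X (L j) -> R)) ->
  (forall j w, 0 <= f j w) ->
  (forall j, (\int[P]_w (f j w)%:E <= (B j)%:E)%E) ->
  (\int[P]_w (\prod_(j < n) f j w)%:E <= (\prod_(j < n) B j)%:E)%E.
Proof.
move=> indep dL mf f0 fB.
elim: n => [|n IH].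
  under eq_integral do rewrite big_ord0.
  by rewrite big_ord0 integral_cst// mul1e probability_le1.
under eq_integral do rewrite big_ord_recr /= EFinM.
rewrite (integral_info_mul R d T P I X indep (\bigcup_(j in `I_n) L j) (L n)
   (fun w => (\prod_(j < n) f j w)%:E) (fun w => (f n w)%:E)).
- rewrite big_ord_recr/= EFinM; apply: lee_pmul => //.
    by apply: integral_ge0 => w _; rewrite lee_fin prodr_ge0.
  by apply: integral_ge0 => w _; rewrite lee_fin.
- rewrite setI_bigcupl bigcup0// => j /= jn; apply: dL => e.
  by move: jn; rewrite e ltnn.
- apply/measurable_EFinP; apply: measurable_prod => j _.
  apply: (measurable_infoS R d T P I X (L j)) => //.
  by move=> i Li; exists j => /=.
- exact/measurable_EFinP.
- by move=> w; rewrite lee_fin prodr_ge0.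
- by move=> w; rewrite lee_fin.
Qed.

(** * Exponential clocks *)

Section density.
Context (R : realType) (m : probability (measurableTypeR R) R) (g : R -> R).
Local Notation mu := (@lebesgue_measure R).
Hypothesis ig : mu.-integrable setT (EFin \o g).
Hypothesis mg : forall A, measurable A -> m A = (\int[mu]_(x in A) (g x)%:E)%E.

Lemma density_dominates : m `<< mu.
Proof.
apply/null_content_dominatesP => A mA A0.
rewrite mg// null_set_integral//.
by apply: measurable_funTS; exact: measurable_int ig.
Qed.

(** The density is almost everywhere the Radon-Nikodym derivative. *)
Lemma integral_density (f : R -> \bar R) :
  m.-integrable setT f ->
  (\int[m]_x f x = \int[mu]_x (f x * (g x)%:E))%E.
Proof.
move=> fi; have mf := measurable_int _ fi.
rewrite -(Radon_Nikodym_change_of_variables density_dominates)//=.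
apply: ae_eq_integral => //.
- apply: emeasurable_funM => //; apply: (measurable_int mu).
  by apply: Radon_Nikodym_integrable; exact: density_dominates.
- apply: emeasurable_funM => //=; exact: measurable_int ig.
- apply: ae_eqe_mul2l => /=.
  rewrite Radon_NikodymE//=; first exact: density_dominates.
  move=> abmu.
  case: cid => /= h [h1 h2 h3].
  apply: integral_ae_eq => //=.
  + exact: measurable_int ig.
  + by move=> E E01 mE; rewrite -h3//= -mg.
Qed.

End density.

Section density_of_RV.
Context (R : realType) (d : measure_display) (T : measurableType d)
  (P : probability T R) (X : {RV P >-> R}) (g : R -> R).
Local Notation mu := (@lebesgue_measure R).
Hypothesis ig : mu.-integrable setT (EFin \o g).
Hypothesis Xg : forall A, measurable A ->
  distribution P X A = (\int[mu]_(x in A) (g x)%:E)%E.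

(** The variable X, read on the copy of the line that carries the Lebesgue
    measure. *)
Let X' : T -> measurableTypeR R := X.
Let mX' : measurable_fun setT X'.
Proof. exact: (measurable_funP X). Qed.
HB.instance Definition _ := isMeasurableFun.Build _ _ _ _ X' mX'.

Lemma integral_RV_density (f : R -> R) (M : R) :
  measurable_fun setT f -> (forall x, 0 <= f x <= M) ->
  (\int[P]_w (f (X w))%:E = \int[mu]_x (f x * g x)%:E)%E.
Proof.
move=> mf f0M.
have mf' : measurable_fun (setT : set (measurableTypeR R)) (EFin \o f).
  exact/measurable_EFinP.
transitivity (\int[distribution P X']_x (f x)%:E)%E.
  rewrite ge0_integral_distribution// => x; rewrite lee_fin.
  by have /andP[] := f0M x.
rewrite (integral_density R (distribution P X') g).
- by apply: eq_integral => x _; rewrite EFinM.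
- exact: ig.
- by move=> A mA; rewrite -Xg.
- apply: measurable_bounded_integrable => //; last first.
    exists M; split; first exact: num_real.
    by move=> y My x _ /=; have /andP[f0 fM] := f0M x; rewrite ger0_norm// (le_trans fM)// ltW.
  by rewrite ltey_eq fin_num_measure.
Qed.

End density_of_RV.

Section exponential_clock.
Context (R : realType) (d : measure_display) (T : measurableType d)
  (P : probability T R) (X : {RV P >-> R}).
Local Notation mu := (@lebesgue_measure R).
Hypothesis hX : forall A, measurable A ->
  distribution P X A = exponential_prob 1 A.

Lemma exponential_lt0 : distribution P X `]-oo, 0[ = 0%E.
Proof.
rewrite hX// /exponential_prob integral0_eq// => x /=; rewrite in_itv/= => x0.
by rewrite lt0_exponential_pdf.
Qed.

Lemma exponential_ge0 : {ae P, forall w, 0 <= X w}.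
Proof.
exists (X @^-1` `]-oo, 0[); split.
- by rewrite -[Y in measurable Y]setTI; exact: (measurable_funP X).
- exact: exponential_lt0.
- by move=> w /= /negP; rewrite -ltNge in_itv.
Qed.

(** Multiplying the exponential density of rate 1 by exp(- r x) gives, up to a
    constant, the exponential density of rate 1 + r. *)
Lemma exponential_pdfD (r x : R) : 0 <= r -> 0 <= x ->
  expR (- (r * x)) * exponential_pdf 1 x = (1 + r)^-1 * exponential_pdf (1 + r) x.
Proof.
move=> r0 x0; rewrite !exponential_pdfE// mul1r -expRD mulKf ?gt_eqF//; last by lra.
by congr expR; ring.
Qed.

Let density (f : R -> R) : measurable_fun setT f -> (forall x, 0 <= f x <= 1) ->
  (\int[P]_w (f (X w))%:E = \int[mu]_x (f x * exponential_pdf 1 x)%:E)%E.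
Proof.
move=> mf f01; apply: (integral_RV_density R d T P X (exponential_pdf 1) _ _ f 1) => //.
- exact: integrable_exponential_pdf.
Qed.

Let expR_le1 (r x : R) : 0 <= r -> 0 <= x -> expR (- (r * x)) <= 1.
Proof. by move=> r0 x0; rewrite expR_le1 oppr_le0 mulr_ge0. Qed.

Let mexp (r : R) : measurable_fun setT (fun x : R => expR (- (r * x))).
Proof.
apply: measurableT_comp => //; apply: measurableT_comp => //.
Qed.

Lemma exponential_laplace (r : R) : 0 <= r ->
  (\int[P]_w (expR (- (r * X w)))%:E = ((1 + r)^-1)%:E)%E.
Proof.
move=> r0.
pose f (x : R) : R := if 0 <= x then expR (- (r * x)) else 0.
have mf : measurable_fun setT f.
  apply: measurable_fun_if => //; last exact: measurable_funTS.
  exact: measurable_fun_ler.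
transitivity (\int[P]_w (f (X w))%:E)%E.
  apply: ge0_ae_eq_integral => //.
  - by apply/measurable_EFinP; exact: (measurableT_comp (mexp r) (measurable_funP X)).
  - by apply/measurable_EFinP; exact: (measurableT_comp mf (measurable_funP X)).
  - by move=> w _; rewrite lee_fin /f; case: ifP => // _; exact: expR_ge0.
  - by apply: filterS exponential_ge0 => w w0 _; rewrite /f w0.
rewrite density//; last first.
  move=> x; rewrite /f; case: ifPn => [x0|_]; last by rewrite lexx ler01.
  by rewrite expR_ge0 expR_le1.
have r1 : 0 < 1 + r by lra.
rewrite -[RHS]mule1 -(integral_exponential_pdf r1) -ge0_integralZl//.
- apply: eq_integral => x _; rewrite /f -EFinM; case: ifPn => [x0|].
    by rewrite exponential_pdfD.
  by rewrite -ltNge => x0; rewrite !lt0_exponential_pdf// !mulr0.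
- by apply/measurable_EFinP; exact: measurable_exponential_pdf.
- by move=> x _; rewrite lee_fin exponential_pdf_ge0// ltW.
- by rewrite lee_fin invr_ge0 ltW.
Qed.

Lemma exponential_laplace_trunc (r t : R) : 0 <= r -> 0 <= t ->
  (\int[P]_w (if (0 <= X w <= t)%R then expR (- (r * X w)) else 0)%:E =
   ((1 - expR (- ((1 + r) * t))) / (1 + r))%:E)%E.
Proof.
move=> r0 t0.
pose f (x : R) : R := if 0 <= x <= t then expR (- (r * x)) else 0.
have mf : measurable_fun setT f.
  apply: measurable_fun_if => //; last exact: measurable_funTS.
  by apply: measurable_and; exact: measurable_fun_ler.
rewrite (density f)//; last first.
  move=> x; rewrite /f; case: ifPn => [/andP[x0 _]|_]; last by rewrite lexx ler01.
  by rewrite expR_ge0 expR_le1.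
have r1 : 0 < 1 + r by lra.
have -> : (\int[mu]_x (f x * exponential_pdf 1 x)%:E =
  ((1 + r)^-1)%:E * exponential_prob (1 + r)%R `[0%R, t]%classic)%E.
  rewrite /exponential_prob -ge0_integralZl//.
  - rewrite [RHS]integral_mkcond/=; apply: eq_integral => x _.
    rewrite patchE /f mem_setE in_itv/=; case: ifPn => [/andP[x0 xt]|_]; last by rewrite mul0r.
    by rewrite exponential_pdfD.
  - by apply/measurable_EFinP/measurable_funTS; exact: measurable_exponential_pdf.
  - by move=> x _; rewrite lee_fin exponential_pdf_ge0// ltW.
  - by rewrite lee_fin invr_ge0 ltW.
have [t00|t00] := eqVneq t 0.
  rewrite t00 mulr0 oppr0 expR0 subrr mul0r /exponential_prob.
  by rewrite set_itv1 integral_set1 mule0.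
rewrite exponential_prob_itv0c ?lt_neqAle 1?eq_sym ?t00//.
by rewrite -EFinB -EFinM mulrC mulNr.
Qed.

End exponential_clock.

(** * Exponential moments of the truncated branching process *)

Section mgf_inequality.
Context (R : realType).
Variables (S m : R).
Hypothesis S0 : 0 < S.
Hypothesis m0 : 0 < m.
Hypothesis S2m : S < 2 * m.

(** The solution K of
    2 + ((S + 1) K + 4 (1 + m) ^ 2 + 4) / (1 + 2m) = K, the equation that makes
    the quadratic part of the bound stable under branching. *)
Definition quad_const : R := (2 * (1 + 2 * m) + 4 * (1 + m) ^+ 2 + 4) / (2 * m - S).

(** Small enough for the quadratic bound on the exponential to apply, and for
    the terms of order K ^ 2 theta ^ 4 to be of order theta ^ 2. *)
Definition mgf_radius : R := (4 * (1 + m + (S + 1) * quad_const))^-1.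

Lemma quad_const_gt0 : 0 < quad_const.
Proof.
have [S0' m0' S2m'] := And3 S0 m0 S2m.
rewrite divr_gt0 ?subr_gt0//; have := sqr_ge0 (1 + m).
by nra.
Qed.

Lemma mgf_radius_gt0 : 0 < mgf_radius.
Proof.
have [S0' m0' S2m'] := And3 S0 m0 S2m.
rewrite invr_gt0; have W0 : 0 < (S + 1) * quad_const.
  by rewrite mulr_gt0 ?quad_const_gt0//; lra.
by rewrite mulr_gt0// ltr_wpDr ?(ltW W0)//; lra.
Qed.

Lemma mgf_radius_bounds (th : R) : `|th| <= mgf_radius ->
  [/\ `|th| <= 1 / 4, `|th| * (1 + m) <= 1 / 4 & (S + 1) * quad_const * `|th| <= 1 / 4].
Proof.
have [S0' m0' S2m'] := And3 S0 m0 S2m.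
have K0 := quad_const_gt0.
have W0 : 0 < (S + 1) * quad_const by rewrite mulr_gt0//; lra.
move=> h.
have {h} : `|th| * (4 * (1 + m + (S + 1) * quad_const)) <= 1.
  by rewrite -ler_pdivlMr ?mul1r//; lra.
have t0 : 0 <= `|th| by [].
have tm : 0 <= `|th| * m by rewrite mulr_ge0// ltW.
have tW : 0 <= `|th| * ((S + 1) * quad_const) by rewrite mulr_ge0// ltW.
move: tm tW; set W := (S + 1) * quad_const; move=> tm tW h.
by split; rewrite ?[W * _]mulrC; lra.
Qed.

(** The case of a ball that has not split yet; e stands for exp(- m t). *)
Lemma mgf_late (th u e : R) : `|th| <= mgf_radius -> `|u| <= 1 -> 0 <= e <= 1 ->
  expR (th * (u * e)) <= 1 + th * u * e + 2 * th ^+ 2.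
Proof.
have [S0' m0' S2m'] := And3 S0 m0 S2m.
move=> /mgf_radius_bounds[h _ _] u1 /andP[e0 e1].
have ue1 : `|u * e| <= 1 by rewrite normrM mulr_ile1// ger0_norm.
have hh : `|th * (u * e)| <= 1 / 4.
  by rewrite normrM (le_trans _ h)// ler_piMr.
apply: le_trans (expR_le_quad R _ _) _.
  by rewrite (le_trans (ler_norm _))// (le_trans hh)//; lra.
rewrite -!mulrA lerD2l ler_pM2l// -[leLHS]real_normK ?num_real//.
rewrite -[leRHS]real_normK ?num_real// ler_pXn2r ?nnegrE//.
by rewrite normrM ler_piMr.
Qed.

(** The case of a ball that has split at time x, with e = exp(- m x): the
    exponent is the sum of the exponents of the bounds for its children, with
    parameter theta e. *)
Lemma mgf_early (th u e : R) : `|th| <= mgf_radius -> `|u| <= 1 -> 0 <= e <= 1 ->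
  expR (th * e * ((1 + m) * u) + (S + 1) * quad_const * (th * e) ^+ 2) <=
  1 + th * u * (1 + m) * e +
  th ^+ 2 * ((S + 1) * quad_const + 4 * (1 + m) ^+ 2 + 4) * e ^+ 2.
Proof.
have [S0' m0' S2m'] := And3 S0 m0 S2m.
move=> /mgf_radius_bounds[h1 h2 h3] u1 /andP[e0 e1].
have K0 := quad_const_gt0.
have W0 : 0 < (S + 1) * quad_const by rewrite mulr_gt0//; lra.
set W := (S + 1) * quad_const in h3 W0 *; clearbody W.
set y1 := th * e * ((1 + m) * u); set y2 := W * (th * e) ^+ 2.
have the : `|th * e| <= `|th| by rewrite normrM (ger0_norm e0) ler_piMr.
have y1b : `|y1| <= `|th| * (1 + m) * e.
  rewrite /y1 !normrM (ger0_norm e0) (_ : `|1 + m| = 1 + m); last by rewrite ger0_norm//; lra.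
  rewrite [leRHS]mulrAC mulrA ler_piMr// !mulr_ge0//; lra.
have y20 : 0 <= y2 by rewrite mulr_ge0 ?sqr_ge0// ltW.
have y2b : y2 <= `|th| * e.
  rewrite /y2 -real_normK ?num_real// expr2 mulrA [in leRHS]mulrC.
  have -> : e * `|th| = 1 * `|th * e| by rewrite normrM (ger0_norm e0) mul1r mulrC.
  rewrite ler_pM ?mulr_ge0 ?(ltW W0)//.
  by rewrite (le_trans (ler_wpM2l (ltW W0) the))//; lra.
apply: le_trans (expR_le_quad R _ _) _.
  have : y1 <= `|y1| by exact: ler_norm.
  have : `|th| * (1 + m) * e <= `|th| * (1 + m) by rewrite ler_piMr// mulr_ge0//; lra.
  have : `|th| * e <= `|th| by rewrite ler_piMr.
  by lra.
have y1s : y1 ^+ 2 <= th ^+ 2 * (1 + m) ^+ 2 * e ^+ 2.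
  rewrite -!exprMn -[leLHS]real_normK ?num_real// -[leRHS]real_normK ?num_real//.
  rewrite ler_pXn2r ?nnegrE// (le_trans y1b)// !normrM (ger0_norm e0).
  by rewrite (_ : `|1 + m| = 1 + m)// ger0_norm//; lra.
have y2s : y2 ^+ 2 <= th ^+ 2 * e ^+ 2.
  by rewrite -exprMn -[leRHS]real_normK ?num_real// ler_pXn2r ?nnegrE// normrM (ger0_norm e0).
have : (y1 + y2) ^+ 2 <= 2 * y1 ^+ 2 + 2 * y2 ^+ 2.
  rewrite -subr_ge0 (_ : _ - _ = (y1 - y2) ^+ 2) ?sqr_ge0//; ring.
move=> hsq.
have y1E : y1 = th * u * (1 + m) * e by rewrite /y1; ring.
have y2E : y2 = W * th ^+ 2 * e ^+ 2 by rewrite /y2; ring.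
move: hsq y1s y2s; rewrite -y1E.
have -> : th ^+ 2 * (W + 4 * (1 + m) ^+ 2 + 4) * e ^+ 2 =
   y2 + 4 * (th ^+ 2 * (1 + m) ^+ 2 * e ^+ 2) + 4 * (th ^+ 2 * e ^+ 2).
  by rewrite y2E; ring.
clear; lra.
Qed.

End mgf_inequality.

Section branching.
Context (R : realType) (a b c d alpha : nat).
Hypothesis hurn : large_urn R a b c d.
Local Notation S := (urn_S R a b).
Local Notation m := (urn_m R a c).
Local Notation K := (quad_const R S m).
Local Notation radius := (mgf_radius R S m).
Context (dT : measure_display) (T : measurableType dT) (P : probability T R).
Variable clock : label -> {RV P >-> R}.
Hypothesis hclock : exponential_clocks clock.

Let m0 := urn_m_gt0 R a b c d hurn.
Let S0 := urn_S_gt0 R a b c d hurn.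
Let S2m := urn_m_gtS R a b c d hurn.

Definition weight (i : nat) (q : seq nat) : R :=
  if red_from a c alpha i q then u2 R a b c (1, 0)%N else u2 R a b c (0, 1)%N.

Lemma norm_weight i q : `|weight i q| <= 1.
Proof.
rewrite /weight; case: ifP => _; first exact: norm_u2_red hurn.
exact: norm_u2_black hurn.
Qed.

(** The children of a ball are the ball itself and the S added ones, which
    contribute m times its weight. *)
Lemma sum_weight_children i q :
  \sum_(j < (a + b).+1) weight i ((j : nat) :: q) = (1 + m) * weight i q.
Proof.
have [Sbal _ _] := hurn.
have key k ur ub : (k <= (a + b).+1)%N ->
   \sum_(j < (a + b).+1) (if (j < k)%N then ur else ub) =
   k%:R * ur + ((a + b).+1 - k)%:R * ub :> R.
  move=> kS; rewrite -(big_mkord xpredT (fun j => if (j < k)%N then ur else ub)).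
  rewrite (@big_cat_nat _ _ _ k)//=; congr (_ + _).
    rewrite big_nat_cond (eq_bigr (fun=> ur)); last by move=> j /andP[/andP[_ ->]].
    by rewrite -big_nat_cond sumr_const_nat subn0 mulr_natl.
  rewrite big_nat_cond (eq_bigr (fun=> ub)); last first.
    by move=> j /andP[/andP[kj _] _]; rewrite ltnNge kj.
  by rewrite -big_nat_cond sumr_const_nat mulr_natl.
have red := u2_red R a b c; have black := u2_black R a b c.
have S0' := S0; rewrite /weight /=; case: ifPn => _.
  rewrite (key a.+1)//; last by rewrite ltnS leq_addr.
  rewrite subSS addKn red black -natr1.
  by rewrite /urn_m; ring.
rewrite (key c)//; last by rewrite Sbal leqW// leq_addr.
rewrite Sbal -addnS addKn red black (urn_mE R a b c d)// -natr1; ring.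
Qed.

(** The discounted sum exp(- m t) u2 over the descent, at age t, of the ball
    (i, q), where a ball of the n-th generation is frozen at birth: it counts
    for its weight discounted at its birth time.  The frozen contribution is the
    mean of what it replaces, which keeps the first moment constant in n. *)
Fixpoint generations (n i : nat) (q : seq nat) (t : R) (w : T) : R :=
  if n is n'.+1 then
    if t < clock (i, q) w then weight i q * expR (- (m * t))
    else expR (- (m * clock (i, q) w)) *
      \sum_(j < (a + b).+1) generations n' i ((j : nat) :: q) (t - clock (i, q) w) w
  else weight i q.

Definition descent (i : nat) (q : seq nat) : set label :=
  [set l | l.1 = i /\ exists p, l.2 = p ++ q].

Lemma descent_child i q j : descent i (j :: q) `<=` descent i q.
Proof. by move=> l [e [p ep]]; split => //; exists (rcons p j); rewrite cat_rcons. Qed.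

Lemma descent_self i q : descent i q (i, q).
Proof. by split => //; exists [::]. Qed.

Lemma descent_child_disjoint i q j k : j <> k ->
  descent i (j :: q) `&` descent i (k :: q) = set0.
Proof.
move=> jk; apply/seteqP; split => // l [[_ [p e]] [_ [p' e']]]; apply: jk.
have e2 : p' ++ k :: q = p ++ j :: q by rewrite -e -e'.
have sz : size p' = size p by have := congr1 size e2; rewrite !size_cat /=; lia.
by move/eqP: e2; rewrite eqseq_cat// => /andP[_ /eqP[->]].
Qed.

Lemma descent_child_self i q j : ~ descent i (j :: q) (i, q).
Proof. by move=> [_ [p /(congr1 size)]] /=; rewrite size_cat /=; lia. Qed.

Local Notation finfo L := (info R dT T P label clock L).

(** Jointly in the age and in the clocks of the descent: the age of the children
    depends on the clock of their parent. *)
Lemma measurable_generations n i q L : descent i q `<=` L ->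
  measurable_fun (setT : set (R * finfo L))
    (fun z : R * finfo L => generations n i q z.1 z.2).
Proof.
elim: n i q => [|n IH] i q qL /=; first exact: measurable_cst.
have mclock : measurable_fun (setT : set (R * finfo L)) (fun z : R * finfo L => clock (i, q) z.2).
  apply: (measurableT_comp (f := clock (i, q) : finfo L -> R)) => //.
  by apply: measurable_clock_info; apply: qL; exact: descent_self.
have mt : measurable_fun (setT : set (R * finfo L)) (fun z : R * finfo L => z.1 : R).
  exact: measurable_fst.
apply: measurable_fun_if => //.
- exact: measurable_fun_ltr.
- apply: measurable_funTS; apply: measurable_funM => //.
  by do 2 apply: measurableT_comp => //; exact: measurable_funM.
apply: measurable_funTS; apply: measurable_funM.
  by do 2 apply: measurableT_comp => //; exact: measurable_funM.
apply: measurable_sum => j.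
have mf : measurable_fun (setT : set (R * finfo L))
    (fun z : R * finfo L => generations n i ((j : nat) :: q) z.1 z.2).
  by apply: IH; apply: subset_trans qL; exact: descent_child.
have mg : measurable_fun (setT : set (R * finfo L))
    ((fun z => (z.1 - clock (i, q) z.2, z.2)) : R * finfo L -> R * finfo L).
  apply/measurable_fun_pairP; split; last exact: measurable_snd.
  exact: measurable_funB.
exact: (measurableT_comp mf mg).
Qed.

Lemma measurable_generations_T n i q t :
  measurable_fun setT (fun w => generations n i q t w).
Proof.
have := measurable_generations n i q setT (@subsetT _ _).
move=> mg; have mp := @measurable_pair1 _ _ R (finfo setT) t.
exact: (measurable_info R dT T P label clock setT _ _ _ (measurableT_comp mg mp)).
Qed.

(** The children use disjoint sets of clocks, so the moment generating function
    factorizes. *)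
Lemma mgf_children n i q (x s th : R) : 0 <= x -> 0 <= s -> `|th| <= radius ->
  (forall j (th' : R), `|th'| <= radius ->
    (\int[P]_w (expR (th' * generations n i (j :: q) s w))%:E <=
     (expR (th' * weight i (j :: q) + K * th' ^+ 2))%:E)%E) ->
  (\int[P]_w (expR (th * (expR (- (m * x)) *
      \sum_(j < (a + b).+1) generations n i ((j : nat) :: q) s w)))%:E <=
   (expR (th * expR (- (m * x)) * ((1 + m) * weight i q) +
          (S + 1) * K * (th * expR (- (m * x))) ^+ 2))%:E)%E.
Proof.
move=> x0 s0 hth IH; set e := expR _.
have e01 : 0 <= e <= 1 by rewrite expR_ge0 expR_le1 oppr_le0 mulr_ge0// ltW.
have hthe : `|th * e| <= radius.
  by case/andP: e01 => e0 e1; rewrite normrM (le_trans _ hth)// ler_piMr// ger0_norm.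
under eq_integral do rewrite mulrA mulr_sumr expR_sum.
have -> : th * e * ((1 + m) * weight i q) + (S + 1) * K * (th * e) ^+ 2 =
   \sum_(j < (a + b).+1) (th * e * weight i ((j : nat) :: q) + K * (th * e) ^+ 2).
  rewrite big_split/= -mulr_sumr sum_weight_children sumr_const card_ord -mulr_natl.
  by rewrite -(natr1 (a + b)) [in LHS]mulrA [in RHS]mulrA [in RHS]mulrA.
rewrite expR_sum.
apply: (integral_info_prod_le R dT T P label clock (fun j => descent i (j :: q))
  (fun j w => expR (th * e * generations n i (j :: q) s w))
  (fun j => expR (th * e * weight i (j :: q) + K * (th * e) ^+ 2))).
- exact: hclock.1.
- by move=> j k jk; exact: descent_child_disjoint.
- move=> j; apply: measurableT_comp => //; apply: measurable_funM => //.
  have mg := measurable_generations n i (j :: q) _ (@subset_refl _ (descent i (j :: q))).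
  exact: (measurableT_comp mg (@measurable_pair1 _ _ R (finfo _) s)).
- by move=> j w; exact: expR_ge0.
- by move=> j; exact: IH.
Qed.

(** The bound on the conditional moment generating function when the clock of
    the ball rings at x. *)
Definition split_bound (i : nat) (q : seq nat) (t th x : R) : R :=
  if t < x then expR (th * (weight i q * expR (- (m * t))))
  else expR (th * expR (- (m * x)) * ((1 + m) * weight i q) +
          (S + 1) * K * (th * expR (- (m * x))) ^+ 2).

Lemma measurable_split_bound i q (t th : R) :
  measurable_fun setT (fun x => (split_bound i q t th x)%:E).
Proof.
apply/measurable_EFinP; apply: measurable_fun_if => //.
  exact: measurable_fun_ltr.
apply: measurable_funTS; apply: measurableT_comp => //.
have me : measurable_fun setT (fun x : R => expR (- (m * x))).
  by do 2 apply: measurableT_comp => //; exact: mulrl_measurable.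
apply: measurable_funD; first by do 2 apply: measurable_funM => //.
by apply: measurable_funM => //; apply: measurable_funX; exact: measurable_funM.
Qed.

Lemma generations_split n i q (t th : R) : 0 <= t -> `|th| <= radius ->
  (forall j s (th' : R), 0 <= s -> `|th'| <= radius ->
    (\int[P]_w (expR (th' * generations n i (j :: q) s w))%:E <=
     (expR (th' * weight i (j :: q) + K * th' ^+ 2))%:E)%E) ->
  (\int[P]_w (expR (th * generations n.+1 i q t w))%:E <=
   \int[P]_w (split_bound i q t th (clock (i, q) w))%:E)%E.
Proof.
move=> t0 hth IH.
pose L := \bigcup_j descent i (j :: q).
pose h (x : R) w : \bar R := (expR (th * (if t < x then weight i q * expR (- (m * t))
    else expR (- (m * x)) *
      \sum_(j < (a + b).+1) generations n i ((j : nat) :: q) (t - x) w)))%:E.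
have mh : measurable_fun (setT : set (R * finfo L)) (fun z : R * finfo L => h z.1 z.2).
  have mt : measurable_fun (setT : set (R * finfo L)) (fun z : R * finfo L => z.1 : R).
    exact: measurable_fst.
  apply/measurable_EFinP; apply: measurableT_comp => //; apply: measurable_funM => //.
  apply: measurable_fun_if => //.
  - exact: measurable_fun_ltr.
  - apply: measurable_funTS; apply: measurable_funM => //.
    by do 2 apply: measurableT_comp => //; exact: measurable_funM.
  apply: measurable_sum => j.
  have mf : measurable_fun (setT : set (R * finfo L))
      (fun z : R * finfo L => generations n i ((j : nat) :: q) z.1 z.2).
    by apply: measurable_generations => l lj; exists (j : nat).
  have mg : measurable_fun (setT : set (R * finfo L))
      ((fun z => (t - z.1, z.2)) : R * finfo L -> R * finfo L).
    apply/measurable_fun_pairP; split; last exact: measurable_snd.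
    exact: measurable_funB.
  exact: (measurableT_comp mf mg).
have h0 x w : (0 <= h x w)%E by rewrite lee_fin expR_ge0.
have nL : ~ L (i, q) by move=> [j _]; exact: descent_child_self.
rewrite (_ : (\int[P]_w _)%E = (\int[P]_w h (clock (i, q) w) w)%E)//.
have msplit := measurable_split_bound i q t th.
have split0 x : (0 <= (split_bound i q t th x)%:E)%E.
  by rewrite lee_fin /split_bound; case: ifP => _; exact: expR_ge0.
rewrite (integral_clock_info R dT T P label clock hclock.1 L)//.
rewrite -(@ge0_integral_distribution _ _ _ _ _ P (clock (i, q)) _ msplit split0).
apply: ae_ge0_le_integral => //.
- by move=> x _; exact: integral_ge0.
- exact: (measurable_integral_info R dT T P label clock L h mh h0).
exists (`]-oo, 0[%classic); split => //.
- exact: exponential_lt0 (hclock.2 (i, q)).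
move=> x /= H; rewrite in_itv/= ltNge; apply/negP => x0; apply: H => _.
rewrite /split_bound /h; case: ifPn => tx.
  by rewrite integral_cst// [X in (_ * X)%E](probability_setT P) mule1.
apply: mgf_children => //; first by rewrite subr_ge0 leNgt.
by move=> j th' hth'; apply: IH => //; rewrite subr_ge0 leNgt.
Qed.

End branching.

Section linear_combination.
Context (R : realType) (d : measure_display) (T : measurableType d)
  (P : probability T R).

Lemma integrable_unit_bounded (g : T -> R) : measurable_fun setT g ->
  (forall w, 0 <= g w <= 1) -> P.-integrable setT (EFin \o g).
Proof.
move=> mg g01; apply: measurable_bounded_integrable => //.
  by rewrite ltey_eq fin_num_measure.
exists 1; split; first exact: num_real.
move=> y y1 w _ /=; have /andP[g0 g1] := g01 w.
by rewrite ger0_norm// (le_trans g1)// ltW.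
Qed.

(** For real coefficients of any sign, hence through integrability. *)
Lemma integral_affine (g1 g2 g3 : T -> R) (c0 c1 c2 c3 I1 I2 I3 : R) :
  (forall w, 0 <= g1 w <= 1) -> (forall w, 0 <= g2 w <= 1) ->
  (forall w, 0 <= g3 w <= 1) -> measurable_fun setT g1 ->
  measurable_fun setT g2 -> measurable_fun setT g3 ->
  (\int[P]_w (g1 w)%:E = I1%:E)%E -> (\int[P]_w (g2 w)%:E = I2%:E)%E ->
  (\int[P]_w (g3 w)%:E = I3%:E)%E ->
  (\int[P]_w (c0 + c1 * g1 w + c2 * g2 w + c3 * g3 w)%:E =
   (c0 + c1 * I1 + c2 * I2 + c3 * I3)%:E)%E.
Proof.
move=> b1 b2 b3 m1 m2 m3 e1 e2 e3.
have iZ (c : R) (g : T -> R) : measurable_fun setT g -> (forall w, 0 <= g w <= 1) ->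
    P.-integrable setT (EFin \o (fun w => c * g w)).
  by move=> mg hg; exact: (integrableZl measurableT c (integrable_unit_bounded g mg hg)).
have eZ (c : R) (g : T -> R) (I : R) : measurable_fun setT g -> (forall w, 0 <= g w <= 1) ->
    (\int[P]_w (g w)%:E = I%:E)%E -> (\int[P]_w (c * g w)%:E = (c * I)%:E)%E.
  move=> mg hg e; under eq_integral do rewrite EFinM.
  by rewrite integralZl//; [rewrite e|exact: integrable_unit_bounded].
have i0 : P.-integrable setT (EFin \o (cst c0 : T -> R)) by exact: finite_measure_integrable_cst.
have i1 : P.-integrable setT (EFin \o (fun w => c0 + c1 * g1 w)) :=
  integrableD measurableT i0 (iZ c1 _ m1 b1).
have i2 : P.-integrable setT (EFin \o (fun w => c0 + c1 * g1 w + c2 * g2 w)) :=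
  integrableD measurableT i1 (iZ c2 _ m2 b2).
under eq_integral do rewrite EFinD.
rewrite (integralD_EFin measurableT i2 (iZ c3 _ m3 b3)) (eZ c3 _ _ m3 b3 e3).
under eq_integral do rewrite /= EFinD.
rewrite (integralD_EFin measurableT i1 (iZ c2 _ m2 b2)) (eZ c2 _ _ m2 b2 e2).
under eq_integral do rewrite /= EFinD.
rewrite (integralD_EFin measurableT i0 (iZ c1 _ m1 b1)) (eZ c1 _ _ m1 b1 e1).
have -> : (\int[P]_w (cst c0 w)%:E = c0%:E)%E.
  apply: etrans (integral_cst P measurableT c0%:E) _.
  by rewrite [X in (_ * X)%E](probability_setT P) mule1.
by rewrite -!EFinD.
Qed.

End linear_combination.

Section branching_bound.
Context (R : realType) (a b c d alpha : nat).
Hypothesis hurn : large_urn R a b c d.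
Local Notation S := (urn_S R a b).
Local Notation m := (urn_m R a c).
Local Notation K := (quad_const R S m).
Local Notation radius := (mgf_radius R S m).
Context (dT : measure_display) (T : measurableType dT) (P : probability T R).
Variable clock : label -> {RV P >-> R}.
Hypothesis hclock : exponential_clocks clock.

(** Both cases of the split are bounded by one affine combination psi of
    truncated exponentials of the clock, at rates 0, m and 2m.  The first order
    terms of its integral add up to theta u, because
    exp(- (1 + m) t) + (1 + m) E [exp(- m c); c <= t] = 1, and the choice of the
    constant K bounds the others by K theta ^ 2. *)
Lemma integral_split_bound i q (t th : R) : 0 <= t -> `|th| <= radius ->
  (\int[P]_w (split_bound R a b c alpha i q t th (clock (i, q) w))%:E <=
   (expR (th * weight R a b c alpha i q + K * th ^+ 2))%:E)%E.
Proof.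
move=> t0 hth.
have m0 := urn_m_gt0 R a b c d hurn; have S0 := urn_S_gt0 R a b c d hurn.
have S2m := urn_m_gtS R a b c d hurn.
have u1 := norm_weight R a b c d alpha hurn i q.
set u := weight R a b c alpha i q in u1 *; set X := clock (i, q).
pose E (r : R) w := if (0 <= X w <= t)%R then expR (- (r * X w)) else 0.
have E01 r w : 0 <= r -> 0 <= E r w <= 1.
  move=> r0; rewrite /E; case: ifPn => [/andP[x0 _]|_]; last by rewrite lexx ler01.
  by rewrite expR_ge0 expR_le1 oppr_le0 mulr_ge0.
have mE r : measurable_fun setT (E r).
  apply: measurable_fun_if => //.
    by apply: measurable_and; apply: measurable_fun_ler.
  apply: measurable_funTS; do 2 apply: measurableT_comp => //.
  exact: measurable_funM.
have IE r : 0 <= r -> (\int[P]_w (E r w)%:E = ((1 - expR (- ((1 + r) * t))) / (1 + r))%:E)%E.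
  by move=> r0; exact: (exponential_laplace_trunc R dT T P X (hclock.2 (i, q)) r t).
pose V := th ^+ 2 * ((S + 1) * K + 4 * (1 + m) ^+ 2 + 4).
pose em := expR (- (m * t)).
have em01 : 0 <= em <= 1 by rewrite expR_ge0 expR_le1 oppr_le0 mulr_ge0// ltW.
pose psi w : R := (1 + th * u * em + 2 * th ^+ 2) + (- (th * u * em + 2 * th ^+ 2)) * E 0 w +
   (th * u * (1 + m)) * E m w + V * E (2 * m) w.
have mpsi : measurable_fun setT psi.
  by apply: measurable_funD; [apply: measurable_funD; [apply: measurable_funD|]|] => //; exact: measurable_funM.
have split_psi w : 0 <= X w -> split_bound R a b c alpha i q t th (X w) <= psi w.
  move=> x0; rewrite /split_bound -/u /psi /E x0 /=; case: ltP => tx.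
    rewrite !mulr0 !addr0; apply: le_trans (mgf_late R S m S0 m0 S2m th u em hth u1 em01) _.
    by rewrite -!mulrA.
  have e01 : 0 <= expR (- (m * X w)) <= 1 by rewrite expR_ge0 expR_le1 oppr_le0 mulr_ge0// ltW.
  apply: le_trans (mgf_early R S m S0 m0 S2m th u _ hth u1 e01) _.
  rewrite -/V mul0r oppr0 expR0 mulr1.
  have -> : expR (- (2 * m * X w)) = expR (- (m * X w)) ^+ 2.
    by rewrite expr2 -expRD; congr expR; ring.
  rewrite le_eqVlt; apply/orP; left; apply/eqP; ring.
have ae0 := exponential_ge0 R dT T P X (hclock.2 (i, q)).
have split0 w : 0 <= split_bound R a b c alpha i q t th (X w).
  by rewrite /split_bound; case: ifP => _; exact: expR_ge0.
apply: (@le_trans _ _ (\int[P]_w (Num.max 0 (psi w))%:E)%E).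
  apply: ae_ge0_le_integral => //.
  - by move=> w _; rewrite lee_fin.
  - exact: (measurableT_comp (measurable_split_bound R a b c alpha i q t th) (measurable_funP X)).
  - by move=> w _; rewrite lee_fin le_max lexx.
  - by apply/measurable_EFinP; exact: measurable_maxr.
  - by apply: filterS ae0 => w w0 _; rewrite lee_fin le_max split_psi// orbT.
have -> : (\int[P]_w (Num.max 0 (psi w))%:E = \int[P]_w (psi w)%:E)%E.
  apply: ae_eq_integral => //.
  - by apply/measurable_EFinP; exact: measurable_maxr.
  - exact/measurable_EFinP.
  - apply: filterS ae0 => w w0 _ /=; congr (_%:E); apply/max_idPr.
    exact: le_trans (split0 w) (split_psi w w0).
have m2 : 0 <= 2 * m by rewrite mulr_ge0// ltW.
rewrite (integral_affine R dT T P (E 0) (E m) (E (2 * m)) _ _ _ _ _ _ _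
  (fun w => E01 0 w (lexx _)) (fun w => E01 m w (ltW m0)) (fun w => E01 (2 * m) w m2)
  (mE 0) (mE m) (mE (2 * m)) (IE 0 (lexx _)) (IE m (ltW m0)) (IE (2 * m) m2)).
rewrite lee_fin; apply: le_trans (expR_ge1Dx _).
have -> : (1 - expR (- ((1 + 0) * t))) / (1 + 0) = 1 - expR (- t).
  by rewrite addr0 divr1 mul1r.
have -> : th * u * (1 + m) * ((1 - expR (- ((1 + m) * t))) / (1 + m)) = th * u * (1 - em * expR (- t)).
  rewrite -[LHS]mulrA [(1 + m) * _]mulrC divfK; last by rewrite gt_eqF//; lra.
  by rewrite /em -expRD; congr (_ * (1 - expR _)); ring.
have V0 : 0 <= V.
  have K0 := ltW (quad_const_gt0 R S m S0 m0 S2m).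
  have W0 : 0 <= (S + 1) * K by rewrite mulr_ge0//; lra.
  have Q0 : 0 <= 4 * (1 + m) ^+ 2 by rewrite mulr_ge0 ?sqr_ge0.
  by apply: mulr_ge0; [exact: sqr_ge0|lra].
have : V * ((1 - expR (- ((1 + 2 * m) * t))) / (1 + 2 * m)) <= V / (1 + 2 * m).
  rewrite (ler_wpM2l V0)// -[leRHS]mul1r ler_pM2r ?invr_gt0; last by lra.
  by rewrite gerBl expR_ge0.
have VK : V / (1 + 2 * m) = th ^+ 2 * (K - 2).
  have fld (x y z w : R) : 2 * x - y != 0 -> 1 + 2 * x != 0 ->
      w = (2 * (1 + 2 * x) + 4 * z + 4) / (2 * x - y) ->
      ((y + 1) * w + 4 * z + 4) / (1 + 2 * x) = w - 2.
    by move=> h1 h2 ->; field; apply/andP.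
  rewrite /V -mulrA (fld _ _ _ K)//; last by rewrite gt_eqF//; lra.
  by rewrite subr_eq0 gt_eqF.
rewrite VK; have : th ^+ 2 * expR (- t) <= th ^+ 2.
  by rewrite ler_piMr ?sqr_ge0// expR_le1 oppr_le0.
set A1 := V * _; set A2 := th ^+ 2 * expR _; move=> h1 h2.
rewrite [leLHS](_ : _ = 1 + th * u + 2 * A2 + A1); last by rewrite /A2; ring.
lra.
Qed.

(** The bound does not depend on n nor on t; the initial value is exp(theta u)
    and splitting preserves the bound. *)
Theorem generations_mgf n i q (t th : R) : 0 <= t -> `|th| <= radius ->
  (\int[P]_w (expR (th * generations R a b c alpha dT T P clock n i q t w))%:E <=
   (expR (th * weight R a b c alpha i q + K * th ^+ 2))%:E)%E.
Proof.
elim: n i q t th => [|n IH] i q t th t0 hth.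
  rewrite /= integral_cst// [X in (_ * X)%E](probability_setT P) mule1 lee_fin ler_expR.
  rewrite lerDl mulr_ge0 ?sqr_ge0// ltW// quad_const_gt0//.
  - exact: urn_S_gt0 hurn.
  - exact: urn_m_gt0 hurn.
  - exact: urn_m_gtS hurn.
apply: le_trans (integral_split_bound i q t th t0 hth).
by apply: (generations_split R a b c d alpha) => // j s th'; exact: IH.
Qed.

End branching_bound.

(** * Non-explosion *)

Section words.
Variable k : nat.

(** Letters are added on the side of the root of the tree, as a label lists the
    most recent step first. *)
Fixpoint words (n : nat) : seq (seq nat) :=
  if n is n'.+1 then [seq rcons p j | j <- iota 0 k, p <- words n'] else [:: [::]].

Lemma mem_words n p : (p \in words n) = (size p == n) && all (fun j => j < k)%N p.
Proof.
elim: n p => [|n IH] p; first by rewrite inE; case: p.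
apply/allpairsP/andP => [[[j p'] /= [jk p'n ->]]|[/eqP pn pk]].
  move: p'n jk; rewrite IH mem_iota /= add0n all_rcons => /andP[/eqP pn ->] ->.
  by rewrite size_rcons pn.
case/lastP: p pn pk => // p j; rewrite size_rcons all_rcons => -[pn] /andP[jk pk].
by exists (j, p); rewrite /= IH pn eqxx mem_iota.
Qed.

Lemma size_words n : size (words n) = (k ^ n)%N.
Proof. by elim: n => //= n IH; rewrite size_allpairs size_iota IH expnS. Qed.

Lemma uniq_words n : uniq (words n).
Proof.
elim: n => //= n IH; apply: allpairs_uniq => //; first exact: iota_uniq.
by move=> [j p] [j' p'] _ _ /= /rcons_inj[-> ->].
Qed.

Definition words_below n : seq (seq nat) := [seq p | l <- iota 0 n, p <- words l].

Lemma mem_words_below n p :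
  (p \in words_below n) = (size p < n)%N && all (fun j => j < k)%N p.
Proof.
apply/allpairsPdep/andP => [[l [p' [ln p'l ->]]]|[pn pk]].
  by move: ln p'l; rewrite mem_iota mem_words add0n => ln /andP[/eqP -> ->].
by exists (size p), p; rewrite mem_iota mem_words eqxx.
Qed.

Lemma uniq_words_below n : uniq (words_below n).
Proof.
apply: allpairs_uniq_dep => [|l _|]; [exact: iota_uniq|exact: uniq_words|].
move=> [l p] [l' p'] /allpairsPdep[x [y [_ yx e]]] /allpairsPdep[x' [y' [_ yx' e']]] /=.
move: e e' yx yx' => [-> ->] [-> ->]; rewrite !mem_words.
by move=> /andP[/eqP <- _] /andP[/eqP <- _] ->.
Qed.

Lemma big_words_belowS (R : nmodType) n (f : seq nat -> R) :
  \sum_(p <- words_below n.+1) f p =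
  f [::] + \sum_(j <- iota 0 k) \sum_(p <- words_below n) f (rcons p j).
Proof.
rewrite /words_below big_allpairs_dep /= big_cons big_seq1; congr (_ + _).
rewrite (iotaDl 1 0) big_map.
under [RHS]eq_bigr do rewrite big_allpairs_dep/=.
rewrite [RHS]exchange_big/=; apply: eq_bigr => l _.
by rewrite big_allpairs_dep.
Qed.

End words.

Section non_explosion.
Context (R : realType) (k alpha_beta : nat).
Context (dT : measure_display) (T : measurableType dT) (P : probability T R).
Variable clock : label -> {RV P >-> R}.
Hypothesis hclock : exponential_clocks clock.
Local Notation birth := (birth_from clock).
Local Notation finfo L := (info R dT T P label clock L).

(** A birth time depends only on clocks with strictly shorter labels. *)
Definition ancestors (i : nat) (q : seq nat) : set label :=
  [set l | l.1 = i /\ (size l.2 < size q)%N].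

Lemma measurable_birth i q :
  measurable_fun (setT : set (finfo (ancestors i q))) (birth i q : finfo (ancestors i q) -> R).
Proof.
elim: q => [|j q IH] /=; first exact: measurable_cst.
apply: measurable_funD.
  apply: (measurable_infoS R dT T P label clock (ancestors i q)) => // l [e h].
  by split => //=; exact: ltnW.
by apply: measurable_clock_info; split => /=.
Qed.

Lemma measurable_birth_T i q : measurable_fun setT (birth i q : T -> R).
Proof. exact: measurable_info (measurable_birth i q). Qed.

Lemma birth_laplace (r : R) i q : 0 <= r ->
  (\int[P]_w (expR (- (r * birth i q w)))%:E = ((1 + r) ^- size q)%:E)%E.
Proof.
move=> r0; elim: q => [|j q IH] /=.
  under eq_integral do rewrite mulr0 oppr0 expR0.
  by rewrite integral_cst// [X in (_ * X)%E](probability_setT P) mule1 invr1.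
under eq_integral do rewrite mulrDr opprD expRD EFinM.
have mE (L : set label) (f : T -> R) : measurable_fun (setT : set (finfo L)) (f : finfo L -> R) ->
    measurable_fun (setT : set (finfo L)) ((fun w => (expR (- (r * f w)))%:E) : finfo L -> \bar R).
  move=> mf; apply/measurable_EFinP; do 2 apply: measurableT_comp => //.
  exact: measurable_funM.
rewrite (integral_info_mul R dT T P label clock hclock.1 (ancestors i q) [set (i, q)]
  (fun w => (expR (- (r * birth i q w)))%:E) (fun w => (expR (- (r * clock (i, q) w)))%:E)).
- rewrite IH (exponential_laplace R dT T P (clock (i, q)) (hclock.2 (i, q)))//.
  by rewrite -EFinM exprS invfM mulrC.
- by apply/seteqP; split => // l [[_ h] /= e]; move: h; rewrite e ltnn.
- by apply: (mE (ancestors i q) (birth i q)); exact: measurable_birth.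
- by apply: (mE [set (i, q)] (clock (i, q))); exact: measurable_clock_info.
- by move=> w; rewrite lee_fin expR_ge0.
- by move=> w; rewrite lee_fin expR_ge0.
Qed.

Let rate : R := 2 * k%:R + 1.

Let generation_laplace n w : R :=
  \sum_(i <- iota 0 alpha_beta) \sum_(q <- words k n) expR (- (rate * birth i q w)).

(** The labels of generation n are at most k ^ n for each initial ball, and
    each birth time has Laplace transform (1 + rate) ^ - n at rate.  Since
    1 + rate = 2 (k + 1), the Laplace transforms have a finite sum over the whole
    tree.  Almost surely the sum of the exp(- rate birth) is then finite, and a
    generation with a birth before t contributes at least exp(- rate t). *)
Lemma non_explosion : {ae P, forall w, forall t : R, exists N, forall n i q,
  (N <= n)%N -> (i < alpha_beta)%N -> q \in words k n -> t < birth i q w}.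
Proof.
have rate0 : 0 <= rate by rewrite addr_ge0// mulr_ge0.
have g0 n w : 0 <= generation_laplace n w.
  by apply: sumr_ge0 => i _; apply: sumr_ge0 => q _; exact: expR_ge0.
have mE i q : measurable_fun setT (fun w => (expR (- (rate * birth i q w)))%:E).
  apply/measurable_EFinP; do 2 apply: measurableT_comp => //.
  by apply: measurable_funM => //; exact: measurable_birth_T.
have mg n : measurable_fun setT (fun w => (generation_laplace n w)%:E).
  under eq_fun => w.
    rewrite /generation_laplace -sumEFin; under eq_bigr do rewrite -sumEFin.
    over.
  by apply: emeasurable_sum => i; apply: emeasurable_sum => q; exact: mE.
have Ig n : (\int[P]_w (generation_laplace n w)%:E <=
    ((alpha_beta * 2)%:R / (2 ^ (n + 1))%:R)%:E)%E.
  under eq_integral => w _.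
    rewrite /generation_laplace -sumEFin; under eq_bigr do rewrite -sumEFin.
    over.
  rewrite ge0_integral_sum//; last 2 first.
  - by move=> i; apply: emeasurable_sum => q; exact: mE.
  - by move=> i w _; apply: sume_ge0 => q _; rewrite lee_fin expR_ge0.
  rewrite (eq_bigr (fun=> (k%:R ^+ n * (1 + rate) ^- n)%:E)) => [|i _]; last first.
    rewrite ge0_integral_sum//.
    rewrite (eq_big_seq (fun=> ((1 + rate) ^- n)%:E)); last first.
      by move=> q; rewrite mem_words => /andP[/eqP <- _]; exact: birth_laplace.
    rewrite sumEFin big_const_seq count_predT iter_addr addr0 size_words.
    by congr (_%:E); rewrite -[LHS]mulr_natl natrX.
  rewrite sumEFin big_const_seq count_predT iter_addr addr0 size_iota.
  rewrite lee_fin -[leLHS]mulr_natl [leRHS](_ : _ = alpha_beta%:R * 2 ^- n); last first.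
    by rewrite natrM natrX addn1 exprS invfM mulrA mulfK// pnatr_eq0.
  rewrite ler_wpM2l// -!exprVn -exprMn.
  have k0 : (0 : R) <= k%:R by [].
  have r1 : 0 < 1 + rate by rewrite /rate; lra.
  rewrite lerXn2r ?nnegrE ?divr_ge0 ?invr_ge0 ?(ltW r1)//.
  by rewrite ler_pdivrMr// /rate; lra.
have fin : (\int[P]_w (\sum_(n <oo) (generation_laplace n w)%:E) < +oo)%E.
  rewrite integral_nneseries//; last by move=> n w _; rewrite lee_fin.
  apply: le_lt_trans (_ : \sum_(n <oo) ((alpha_beta * 2)%:R / (2 ^ (n + 1))%:R)%:E < +oo)%E.
    by apply: lee_nneseries => // n _ _; apply: integral_ge0 => w _; rewrite lee_fin.
  have /cvg_lim -> // := @cvg_geometric_eseries_half R (alpha_beta * 2)%:R 0.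
  exact: ltry.
pose G w := (\sum_(n <oo) (generation_laplace n w)%:E)%E.
have G0 w : (0 <= G w)%E by apply: nneseries_ge0 => n _ _; rewrite lee_fin.
have iG : P.-integrable setT G.
  apply/integrableP; split.
    by apply: ge0_emeasurable_sum => // n w _ _; rewrite lee_fin.
  by under eq_integral do rewrite gee0_abs//.
apply: filterS (integrable_ae measurableT iG) => w /(_ I) Gfin t.
have Glt : (G w < +oo)%E by rewrite ltey_eq Gfin.
have gw n : xpredT n -> (0 <= (generation_laplace n w)%:E)%E by rewrite lee_fin.
have cvg0 := @nneseries_tail_cvg R (fun n => (generation_laplace n w)%:E) xpredT Glt gw.
have nb := @nbhs_open_ereal_lt R 0 (fun=> expR (- (rate * t))) (expR_gt0 _).
have : \forall N \near \oo,
    (\sum_(N <= n <oo) (generation_laplace n w)%:E < (expR (- (rate * t)))%:E)%E.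
  exact: (cvg0 [set y | (y < (expR (- (rate * t)))%:E)%E] nb).
move=> [N1 _ hN1].
exists N1 => n i q Nn iab qn; rewrite ltNge; apply/negP => bt.
have : (\sum_(n <= l <oo) (generation_laplace l w)%:E < (expR (- (rate * t)))%:E)%E.
  exact: (hN1 n Nn).
apply/negP; rewrite -leNgt.
apply: (@le_trans _ _ (generation_laplace n w)%:E); last first.
  have := @nneseries_lim_ge R (fun l => (generation_laplace l w)%:E) xpredT n n.+1.
  by rewrite big_nat1; apply => l _; rewrite lee_fin.
rewrite lee_fin.
apply: (@le_trans _ _ (expR (- (rate * birth i q w)))).
  by rewrite ler_expR lerN2 ler_wpM2l.
rewrite /generation_laplace (big_rem i) ?mem_iota//=.
rewrite (big_rem q)//= -addrA lerDl addr_ge0//.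
  by apply: sumr_ge0 => p _; exact: expR_ge0.
by apply: sumr_ge0 => i' _; apply: sumr_ge0 => p _; exact: expR_ge0.
Qed.

End non_explosion.

(** * The composition of the urn as a sum over the tree *)

Lemma card_fset_set_filter (I : choiceType) (D : seq I) (b : pred I) (A : set I) :
  uniq D -> (forall x, A x <-> (x \in D) && b x) ->
  #|` fset_set A|%fset = count b D.
Proof.
move=> uD AE.
have -> : A = [set` [fset x in [seq y <- D | b y]]%fset].
  apply/seteqP; split => x /=; rewrite !inE/= mem_filter andbC.
    by move/AE.
  by move=> ?; exact/AE.
by rewrite set_fsetK card_fseq undup_id ?filter_uniq// size_filter.
Qed.

Section urn_composition.
Context (R : realType) (a b c d alpha beta : nat).
Hypothesis hurn : large_urn R a b c d.
Local Notation S := (urn_S R a b).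
Local Notation m := (urn_m R a c).
Local Notation k := (a + b).+1.
Context (dT : measure_display) (T : measurableType dT) (P : probability T R).
Variable clock : label -> {RV P >-> R}.
Local Notation birth i q := (birth_from clock i q).
Local Notation weight := (weight R a b c alpha).
Local Notation generations := (generations R a b c alpha dT T P clock).

(** In a balanced urn every ball has a + b + 1 children. *)
Lemma ball_fromE i q :
  ball_from a b c d alpha beta i q = (i < alpha + beta)%N && all (fun j => j < k)%N q.
Proof.
have [Sbal _ _] := hurn.
elim: q => [|j q IH] /=; first by rewrite andbT.
by rewrite IH -Sbal if_same ltnS -andbA; congr (_ && _); rewrite andbC.
Qed.

Section trajectory.
Variables (w : T) (t : R).
Hypothesis clock_ge0 : forall l, 0 <= clock l w.

Definition alive (i : nat) (q : seq nat) : bool :=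
  (birth i q w <= t) && (t < birth i q w + clock (i, q) w).

Lemma birth_cat i p q : birth i q w <= birth i (p ++ q) w.
Proof.
elim: p => //= j p IH; apply: le_trans IH _.
by rewrite lerDl.
Qed.

Definition alive_weight n i q : R :=
  \sum_(p <- words_below k n) (if alive i (p ++ q) then weight i (p ++ q) else 0).

Lemma alive_weight_unborn n i q : t < birth i q w -> alive_weight n i q = 0.
Proof.
move=> tq; rewrite /alive_weight big1// => p _.
by rewrite /alive leNgt (lt_le_trans tq (birth_cat _ _ _)).
Qed.

Lemma alive_weightS n i q :
  alive_weight n.+1 i q = (if alive i q then weight i q else 0) +
    \sum_(j < k) alive_weight n i ((j : nat) :: q).
Proof.
rewrite /alive_weight big_words_belowS; congr (_ + _).
rewrite -(big_mkord xpredT (fun j => alive_weight n i (j :: q))) /index_iota subn0.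
by apply: eq_bigr => j _; apply: eq_bigr => p _; rewrite cat_rcons.
Qed.

(** When generation n is not born at time t, no ball is frozen and the cut
    process is the discounted sum over the balls that are present. *)
Lemma generations_alive n i q :
  all (fun j => j < k)%N q -> birth i q w <= t ->
  (forall p, p \in words k n -> t < birth i (p ++ q) w) ->
  expR (- (m * birth i q w)) * generations n i q (t - birth i q w) w =
  expR (- (m * t)) * alive_weight n i q.
Proof.
elim: n q => [|n IH] q qk bt late.
  by have := late [::]; rewrite inE eqxx ltNge bt => /(_ isT).
rewrite alive_weightS /= /alive bt /= ltrBlDl; case: ifPn => tb.
  rewrite big1 ?addr0; last by move=> j _; exact: alive_weight_unborn.
  rewrite mulrCA -expRD mulrC; congr (expR _ * _); ring.
rewrite add0r mulrA -expRD mulr_sumr mulr_sumr; apply: eq_bigr => j _.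
rewrite -IH /=.
- by congr (expR _ * generations _ _ _ _ _); ring.
- by rewrite ltn_ord.
- by rewrite leNgt.
- move=> p pn; rewrite -cat_rcons; apply: late.
  by move: pn; rewrite !mem_words size_rcons all_rcons eqSS ltn_ord.
Qed.

(** The balls present all belong to generations before n, so the two finite
    cardinals of the composition count labels in an explicit list. *)
Lemma u2_U_CT n :
  (forall n' i q, (n <= n')%N -> (i < alpha + beta)%N -> q \in words k n' -> t < birth i q w) ->
  u2 R a b c (U_CT a b c d alpha beta clock t w) =
  \sum_(i < alpha + beta) alive_weight n i [::].
Proof.
move=> late.
pose D := [seq (i, p) | i <- iota 0 (alpha + beta), p <- words_below k n].
have uD : uniq D.
  apply: allpairs_uniq; [exact: iota_uniq|exact: uniq_words_below|].
  by move=> [? ?] [? ?] _ _ /= [-> ->].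
have inD l : in_urn a b c d alpha beta clock t w l <-> (l \in D) && alive l.1 l.2.
  case: l => i q; rewrite /in_urn /alive /= ball_fromE; split.
    move=> [/andP[iab qk] bt tb]; rewrite bt tb.
    rewrite !andbT; apply/allpairsPdep; exists i, q; split => //; first by rewrite mem_iota.
    rewrite mem_words_below qk andbT ltnNge; apply/negP => nq.
    have := late (size q) i q nq iab; rewrite mem_words eqxx qk ltNge bt.
    by move=> /(_ isT).
  move=> /andP[/allpairsPdep[i' [q' [iab qn [-> ->]]]] /andP[-> ->]]; split => //.
  by move: iab qn; rewrite mem_iota mem_words_below /= add0n => -> /andP[_ ->].
pose red (l : label) := red_from a c alpha l.1 l.2.
rewrite /U_CT (card_fset_set_filter _ D (fun l => alive l.1 l.2 && red l))//; last first.
  move=> l; rewrite /red; split => [[/inD/andP[-> ->] ->]//|/and3P[lD la lr]].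
  by split => //; apply/inD; rewrite lD.
rewrite (card_fset_set_filter _ D (fun l => alive l.1 l.2 && ~~ red l))//; last first.
  move=> l; rewrite /red; split => [[/inD/andP[-> ->] ->]//|/and3P[lD la lr]].
  by split => //; apply/inD; rewrite lD.
rewrite u2E /= -!sum1_count !natr_sum !mulr_suml.
have -> : \sum_(i < alpha + beta) alive_weight n i [::] =
   \sum_(l <- D) (if alive l.1 l.2 then weight l.1 l.2 else 0).
  rewrite /D big_allpairs_dep /= -(big_mkord xpredT (fun i => alive_weight n i [::])).
  rewrite /index_iota subn0; apply: eq_bigr => i _.
  by rewrite /alive_weight; apply: eq_bigr => p _; rewrite cats0.
rewrite [in LHS]big_mkcond [X in _ + X]big_mkcond -big_split/=.
apply: eq_bigr => l _; rewrite /weight /red !mul1r.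
by case: (alive _ _) => /=; [case: ifP; rewrite /= ?addr0 ?add0r|rewrite addr0].
Qed.

Lemma U_CT_generations n : 0 <= t ->
  (forall n' i q, (n <= n')%N -> (i < alpha + beta)%N -> q \in words k n' -> t < birth i q w) ->
  expR (- (m * t)) * u2 R a b c (U_CT a b c d alpha beta clock t w) =
  \sum_(i < alpha + beta) generations n i [::] t w.
Proof.
move=> t0 late; rewrite (u2_U_CT n)// mulr_sumr; apply: eq_bigr => i _.
rewrite -generations_alive//=; first by rewrite mulr0 oppr0 expR0 mul1r addr0.
by move=> p pn; rewrite cats0; apply: late pn.
Qed.

End trajectory.
End urn_composition.

(** * The continuous time limit *)

Section continuous_time_limit.
Context (R : realType) (a b c d alpha beta : nat).
Hypothesis hurn : large_urn R a b c d.
Local Notation S := (urn_S R a b).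
Local Notation m := (urn_m R a c).
Local Notation K := (quad_const R S m).
Local Notation radius := (mgf_radius R S m).
Context (dT : measure_display) (T : measurableType dT) (P : probability T R).
Variable clock : label -> {RV P >-> R}.
Hypothesis hclock : exponential_clocks clock.
Local Notation generations := (generations R a b c alpha dT T P clock).

Definition urn_generations n (t : R) w : R :=
  \sum_(i < alpha + beta) generations n i [::] t w.

Lemma measurable_urn_generations n t : measurable_fun setT (urn_generations n t).
Proof. by apply: measurable_sum => i; exact: measurable_generations_T. Qed.

Lemma urn_generations_mgf n (t th : R) : 0 <= t -> `|th| <= radius ->
  (\int[P]_w (expR (th * urn_generations n t w))%:E <=
   (\prod_(i < alpha + beta) expR (th * weight R a b c alpha i [::] + K * th ^+ 2))%:E)%E.
Proof.
move=> t0 hth; rewrite /urn_generations.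
under eq_integral do rewrite mulr_sumr expR_sum.
apply: (integral_info_prod_le R dT T P label clock (fun i => descent i [::])
  (fun i w => expR (th * generations n i [::] t w))
  (fun i => expR (th * weight R a b c alpha i [::] + K * th ^+ 2))).
- exact: hclock.1.
- by move=> j l jl; apply/seteqP; split => // x [[e1 _] [e2 _]]; apply: jl; rewrite -e1 -e2.
- move=> i; apply: measurableT_comp => //; apply: measurable_funM => //.
  have mg := measurable_generations R a b c alpha dT T P clock n i [::] _ (@subset_refl _ (descent i [::])).
  exact: (measurableT_comp mg (@measurable_pair1 _ _ R (info R dT T P label clock _) t)).
- by move=> i w; exact: expR_ge0.
- by move=> i; exact: (generations_mgf R a b c d alpha hurn dT T P clock hclock n i [::] t th t0 hth).
Qed.

Lemma ae_clock_ge0 : {ae P, forall w, forall l, 0 <= clock l w}.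
Proof.
have : {ae P, forall w, forall n : nat,
    if choice.unpickle n is Some l then 0 <= clock l w else true}.
  apply: ae_foralln => n; case: (choice.unpickle n) => [l|]; last exact: aeW.
  exact: (exponential_ge0 R dT T P (clock l) (hclock.2 l)).
apply: filterS => w h l; have := h (choice.pickle l).
by rewrite choice.pickleK.
Qed.

Lemma ae_urn_generations : {ae P, forall w, forall t : R, 0 <= t ->
  \forall n \near \oo, urn_generations n t w =
    expR (- (m * t)) * u2 R a b c (U_CT a b c d alpha beta clock t w)}.
Proof.
have := non_explosion R (a + b).+1 (alpha + beta) dT T P clock hclock.
apply: filterS2 ae_clock_ge0 => w w0 /= late t t0.
have [N hN] := late t; exists N => // n /= Nn.
rewrite (U_CT_generations R a b c d alpha beta hurn dT T P clock w t w0 n)//.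
by move=> n' i q nn'; apply: hN; exact: leq_trans nn'.
Qed.

(** Fatou's lemma is applied twice: to n tending to infinity at a fixed integer
    time t, then to t tending to infinity.  The lower limit Z t in n is a
    measurable variable almost surely equal to the exponential of
    e exp(- m t) u2 of the composition, whose own measurability is thus not
    an issue. *)
Theorem urn_CT_moment_determined (W : {RV P >-> R}) :
  is_W_CT a b c d alpha beta clock W -> moment_determined (distribution P W).
Proof.
move=> HW.
have r0 := mgf_radius_gt0 R S m (urn_S_gt0 _ _ _ _ _ hurn)
  (urn_m_gt0 _ _ _ _ _ hurn) (urn_m_gtS _ _ _ _ _ hurn).
have bnd e : `|e| = radius -> (\int[P]_w (expR (e * W w))%:E < +oo)%E.
  move=> er.
  pose C : \bar R := (\prod_(i < alpha + beta) expR (e * weight R a b c alpha i [::] + K * e ^+ 2))%:E.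
  apply: (@le_lt_trans _ _ C); last exact: ltry.
  pose X n t w : \bar R := (expR (e * urn_generations n t w))%:E.
  have mX n t : measurable_fun setT (X n t).
    apply/measurable_EFinP; apply: measurableT_comp => //; apply: measurable_funM => //.
    exact: measurable_urn_generations.
  have X0 n t w : (0 <= X n t w)%E by rewrite lee_fin expR_ge0.
  pose Z (t : nat) w : \bar R := limn_einf (fun n => X n t%:R w).
  have ZE : {ae P, forall w, forall t : nat, X n t%:R w @[n --> \oo] --> Z t w /\
    Z t w = (expR (e * (expR (- (m * t%:R)) * u2 R a b c (U_CT a b c d alpha beta clock t%:R w))))%:E}.
    apply: filterS ae_urn_generations => w hw t.
    have cX : X n t%:R w @[n --> \oo] --> (expR (e * (expR (- (m * t%:R)) * u2 R a b c (U_CT a b c d alpha beta clock t%:R w))))%:E.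
      apply: cvg_near_cst; have := hw t%:R (ler0n _ _).
      by apply: filterS => n hn; rewrite /X hn.
    by rewrite /Z (cvg_limn_einf_sup cX).1.
  apply: (fatou_le R dT T P Z) => //.
  - by move=> t; apply: measurable_limn_einf.
  - apply: (measurableT_comp (measurable_expRM e)); exact: measurable_funP.
  - by move=> t w; apply: limn_einf_ge0.
  - apply: filterS2 ZE HW => w hZ hW.
    have -> : Z ^~ w = (fun t : nat => (expR (e * (expR (- (m * t%:R)) * u2 R a b c (U_CT a b c d alpha beta clock t%:R w))))%:E).
      by apply/funext => t; have [_ ->] := hZ t.
    apply: cvg_EFin; first exact: nearW.
    apply: continuous_cvg; first exact: continuous_expR.
    apply: cvgMr.
    exact: (cvg_comp _ _ (@cvgr_idn R) hW).
  - move=> t; apply: (fatou_le R dT T P (fun n => X n t%:R)) => //.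
    + exact: measurable_limn_einf.
    + by move=> w; apply: limn_einf_ge0.
    + by apply: filterS ZE => w hZ; have [] := hZ t.
    + by move=> n; apply: urn_generations_mgf => //; rewrite er.
apply: (distribution_moment_determined _ _ _ _ _ radius) => //.
  by apply: bnd; rewrite gtr0_norm.
by apply: bnd; rewrite normrN gtr0_norm.
Qed.

End continuous_time_limit.

Theorem corollary2 (R : realType) (a b c d : nat) (alpha beta : nat)
    (hurn : large_urn R a b c d) (h0 : (alpha, beta) <> (0%N, 0%N)) :
  (forall (dT : measure_display) (T : measurableType dT) (P : probability T R)
      (U : nat -> {RV P >-> (nat * nat)%type}) (W : {RV P >-> R}),
    is_urn_DT a b c d alpha beta U -> is_W_DT a b c U W ->
    moment_determined (distribution P W)) /\
  (forall (dT : measure_display) (T : measurableType dT) (P : probability T R)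
      (clock : label -> {RV P >-> R}) (W : {RV P >-> R}),
    exponential_clocks clock -> is_W_CT a b c d alpha beta clock W ->
    moment_determined (distribution P W)).
Proof.
split=> [dT T P U W HU HW|dT T P clock W hclock HW].
  exact: (urn_DT_moment_determined R a b c d alpha beta hurn h0 dT T P U).
exact: (urn_CT_moment_determined R a b c d alpha beta hurn dT T P clock).
Qed.
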